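(* For every $1 \leq p < \infty$ with $p \neq 2$, the Banach spaces $L_p + L_\infty$ and $L_p \cap L_\infty$ (of functions on $(0,\infty)$ with Lebesgue measure) are not isomorphic.
   Context: All functions are real-valued Lebesgue measurable functions on $(0,\infty)$, identified when equal almost everywhere; $L_p = L_p(0,\infty)$ and $L_\infty = L_\infty(0,\infty)$ with respect to Lebesgue measure. The space $L_p + L_\infty$ consists of all sums $u+v$ with $u \in L_p$, $v \in L_\infty$, with the norm $$\|x\|_{L_p+L_\infty} = \inf\{\|u\|_{L_p} + \|v\|_{L_\infty} : x = u+v,\ u \in L_p,\ v \in L_\infty\}.$$ The space $L_p \cap L_\infty$ consists of all functions lying in both $L_p$ and $L_\infty$, with the norm $$\|x\|_{L_p\cap L_\infty} = \max\{\|x\|_{L_p}, \|x\|_{L_\infty}\}.$$ Two Banach spaces are isomorphic if there is a bounded linear bijection between them with bounded inverse. *)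

(* Defs.v *)
From HB Require Import structures.
From mathcomp Require Import all_boot all_order all_algebra generic_quotient.
From mathcomp Require Import all_classical all_reals all_analysis.
From mathcomp Require Import ess_sup_inf measurable_realfun.

Set Implicit Arguments.
Unset Strict Implicit.
Unset Printing Implicit Defensive.

Import Order.TTheory GRing.Theory Num.Theory.
Import numFieldNormedType.Exports.

Local Open Scope classical_set_scope.
Local Open Scope ring_scope.
Local Open Scope quotient_scope.

Section L0.
Context d (T : measurableType d) (R : realType).
Context (mu : {measure set T -> \bar R}).

Local Notation L0 := {mfun_ mu, T >-> R}.

(* The library's space of measurable functions modulo a.e. equality carries no
   algebraic structure: below it receives the operations induced by the
   pointwise ones. *)
Lemma pi_aeE (f : {mfun T >-> R}) :
  \forall x \ae mu, (\pi_L0 f : L0) x = f x.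
Proof.
have : ae_eq_op mu (repr (\pi_L0 f)) f by apply/eqmodP; rewrite reprK.
by move=> /asboolP; apply: filterS => x; exact.
Qed.

Lemma L0P (x y : L0) : (\forall t \ae mu, x t = y t) -> x = y.
Proof.
move=> xy; rewrite -[x]reprK -[y]reprK; apply/eqmodP/asboolP.
by apply: filterS xy => t + _.
Qed.

Definition L0_zero : L0 := \pi_L0 0.
Definition L0_opp (x : L0) : L0 := \pi_L0 (- repr x).
Definition L0_add (x y : L0) : L0 := \pi_L0 (repr x + repr y).
Definition L0_scale (a : R) (x : L0) : L0 := \pi_L0 (a *: repr x).

Lemma L0_zeroE : \forall t \ae mu, L0_zero t = 0.
Proof. by apply: filterS (pi_aeE 0) => t ->. Qed.

Lemma L0_oppE x : \forall t \ae mu, L0_opp x t = - x t.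
Proof. by apply: filterS (pi_aeE (- repr x)) => t ->. Qed.

Lemma L0_addE x y : \forall t \ae mu, L0_add x y t = x t + y t.
Proof. by apply: filterS (pi_aeE (repr x + repr y)) => t ->. Qed.

Lemma L0_scaleE a x : \forall t \ae mu, L0_scale a x t = a * x t.
Proof. by apply: filterS (pi_aeE (a *: repr x)) => t ->. Qed.

Let addA : associative L0_add.
Proof.
move=> x y z; apply: L0P.
have A := L0_addE x (L0_add y z); have B := L0_addE y z.
have C := L0_addE (L0_add x y) z; have D := L0_addE x y.
near=> t; rewrite (near A t)// (near B t)// (near C t)// (near D t)//.
exact: addrA.
Unshelve. all: by end_near. Qed.

Let addC : commutative L0_add.
Proof.
move=> x y; apply: L0P; have A := L0_addE x y; have B := L0_addE y x.
by near=> t; rewrite (near A t)// (near B t)// addrC.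
Unshelve. all: by end_near. Qed.

Let add0 : left_id L0_zero L0_add.
Proof.
move=> x; apply: L0P; have A := L0_addE L0_zero x; have B := L0_zeroE.
by near=> t; rewrite (near A t)// (near B t)// add0r.
Unshelve. all: by end_near. Qed.

Let addN : left_inverse L0_zero L0_opp L0_add.
Proof.
move=> x; apply: L0P; have A := L0_addE (L0_opp x) x; have B := L0_zeroE.
have C := L0_oppE x.
by near=> t; rewrite (near A t)// (near B t)// (near C t)// addNr.
Unshelve. all: by end_near. Qed.

HB.instance Definition _ := GRing.isZmodule.Build L0 addA addC add0 addN.

Let scaleA a b x : L0_scale a (L0_scale b x) = L0_scale (a * b) x.
Proof.
apply: L0P; have A := L0_scaleE a (L0_scale b x); have B := L0_scaleE b x.
have C := L0_scaleE (a * b) x.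
by near=> t; rewrite (near A t)// (near B t)// (near C t)// mulrA.
Unshelve. all: by end_near. Qed.

Let scale1 : left_id 1 L0_scale.
Proof.
move=> x; apply: L0P; have A := L0_scaleE 1 x.
by near=> t; rewrite (near A t)// mul1r.
Unshelve. all: by end_near. Qed.

Let scaleDr : right_distributive L0_scale +%R.
Proof.
move=> a x y; apply: L0P.
have A := L0_scaleE a (x + y); have B := L0_addE x y.
have C := L0_addE (L0_scale a x) (L0_scale a y).
have D := L0_scaleE a x; have E := L0_scaleE a y.
near=> t; rewrite (near A t)// (near B t)// (near C t)// (near D t)//.
by rewrite (near E t)// mulrDr.
Unshelve. all: by end_near. Qed.

Let scaleDl x : {morph L0_scale^~ x : a b / a + b}.
Proof.
move=> a b; apply: L0P.
have A := L0_scaleE (a + b) x.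
have C := L0_addE (L0_scale a x) (L0_scale b x).
have D := L0_scaleE a x; have E := L0_scaleE b x.
near=> t; rewrite (near A t)// (near C t)// (near D t)//.
by rewrite (near E t)// mulrDl.
Unshelve. all: by end_near. Qed.

HB.instance Definition _ :=
  GRing.Zmodule_isLmodule.Build R L0 scaleA scale1 scaleDr scaleDl.

End L0.

Section Lnorm_ae.
Context d (T : measurableType d) (R : realType).
Context (mu : {measure set T -> \bar R}).

Local Notation L0 := {mfun_ mu, T >-> R}.
Implicit Types (x y u v : L0) (p : \bar R).

Lemma le_Lnorm_ae p (f g : T -> R) : (1 <= p)%E ->
    measurable_fun setT f -> measurable_fun setT g ->
    (\forall t \ae mu, `|f t| <= `|g t|) ->
  ('N[mu]_p[EFin \o f] <= 'N[mu]_p[EFin \o g])%E.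
Proof.
move=> p1 mf mg fg; rewrite unlock; case: p p1 => [r| |]//= r1.
  have r0 : 0 <= r by move: r1; rewrite lee_fin; exact: le_trans.
  have mpow (h : T -> R) : measurable_fun setT h ->
      measurable_fun setT (EFin \o (fun t => `|h t| `^ r)).
    move=> mh; apply/measurable_EFinP.
    apply: (@measurableT_comp _ _ _ _ _ _ (@powR R ^~ r)) => //.
    exact: measurableT_comp.
  apply: gt0_ler_poweR; rewrite ?invr_ge0 ?in_itv/= ?leey ?andbT//.
  - by apply: integral_ge0 => t _; rewrite lee_fin powR_ge0.
  - by apply: integral_ge0 => t _; rewrite lee_fin powR_ge0.
  - apply: ae_ge0_le_integral; try exact: mpow; first exact: measurableT.
    + by move=> t _; rewrite lee_fin powR_ge0.
    + by move=> t _; rewrite lee_fin powR_ge0.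
    + apply: filterS fg => t fgt _.
      by rewrite lee_fin ge0_ler_powR ?nnegrE.
case: ifPn => // _; apply: le_ess_sup.
by apply: filterS fg => t; rewrite lee_fin.
Qed.

Lemma eq_Lnorm_ae p (f g : T -> R) : (1 <= p)%E ->
    measurable_fun setT f -> measurable_fun setT g ->
    (\forall t \ae mu, f t = g t) ->
  ('N[mu]_p[EFin \o f] = 'N[mu]_p[EFin \o g])%E.
Proof.
move=> p1 mf mg fg; apply/eqP; rewrite eq_le; apply/andP; split.
  by apply: le_Lnorm_ae => //; apply: filterS fg => t ->.
by apply: le_Lnorm_ae => //; apply: filterS fg => t ->.
Qed.

Lemma ae_le_Lnormy (f : T -> R) : measurable_fun setT f ->
  \forall t \ae mu, (`|f t|%:E <= 'N[mu]_+oo[EFin \o f])%E.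
Proof.
move=> mf; rewrite unlock/=; case: ifPn => mu0; first exact: ess_sup_ge.
exists setT; split => //; apply/eqP; rewrite eq_le measure_ge0 andbT.
by rewrite leNgt.
Qed.

Lemma measurable_L0 x : measurable_fun setT (x : T -> R).
Proof. by rewrite /aqEqMfun_to_fun; exact: measurable_funPT. Qed.
Hint Resolve measurable_L0 : core.

Definition in_Lp p x : Prop := finite_norm mu p x.

(* junk value 0 outside L_p, where it is never used *)
Definition L0norm p x : R := fine ('N[mu]_p[EFin \o (x : T -> R)]).

Lemma in_LpE p x : in_Lp p x ->
  ('N[mu]_p[EFin \o (x : T -> R)])%E = (L0norm p x)%:E.
Proof.
by move=> fx; rewrite fineK// ge0_fin_numE// Lnorm_ge0.
Qed.

Lemma L0norm_ge0 p x : 0 <= L0norm p x.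
Proof. by rewrite fine_ge0// Lnorm_ge0. Qed.

Section fixed_exponent.
Context p (p1 : (1 <= p)%E).

Lemma in_Lp0 : in_Lp p 0.
Proof.
rewrite /in_Lp /finite_norm (@eq_Lnorm_ae _ _ (cst 0))//; last exact: L0_zeroE.
exact: finite_norm_cst0.
Qed.

Let LnormD x y : ('N[mu]_p[EFin \o aqEqMfun_to_fun (x + y)%R] <=
  'N[mu]_p[EFin \o (x : T -> R)] + 'N[mu]_p[EFin \o (y : T -> R)])%E.
Proof.
rewrite (@eq_Lnorm_ae _ (aqEqMfun_to_fun (x + y))
  ((x : T -> R) \+ (y : T -> R)))//.
- exact: eminkowski.
- exact: L0_addE.
Qed.

Lemma in_LpD x y : in_Lp p x -> in_Lp p y ->
  in_Lp p (x + y).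
Proof.
move=> fx fy; rewrite /in_Lp /finite_norm.
by rewrite (le_lt_trans (LnormD _ _))// lte_add_pinfty.
Qed.

Lemma L0normD x y : in_Lp p x -> in_Lp p y ->
  L0norm p (x + y) <= L0norm p x + L0norm p y.
Proof.
move=> fx fy; rewrite -lee_fin EFinD -!in_LpE//.
exact: in_LpD.
Qed.

Let LnormZ a x : in_Lp p x ->
  ('N[mu]_p[EFin \o aqEqMfun_to_fun (a *: x)%R] =
   `|a|%:E * 'N[mu]_p[EFin \o (x : T -> R)])%E.
Proof.
move=> fx; have xP : (x : T -> R) \in Lfun mu p.
  by apply/andP; split; rewrite inE//=; exact: measurable_L0.
rewrite -(LnormZ (Lfun_Sub p1 xP)).
by apply: eq_Lnorm_ae => //; [exact: measurable_funM|exact: L0_scaleE].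
Qed.

Lemma in_LpZ a x : in_Lp p x -> in_Lp p (a *: x).
Proof.
by move=> fx; rewrite /in_Lp /finite_norm LnormZ// in_LpE// -EFinM ltry.
Qed.

Lemma L0normZ a x : in_Lp p x -> L0norm p (a *: x) = `|a| * L0norm p x.
Proof.
by move=> fx; apply: EFin_inj; rewrite EFinM -!in_LpE ?LnormZ//; exact: in_LpZ.
Qed.

Lemma L0norm_eq0 x : in_Lp p x -> L0norm p x = 0 -> x = 0.
Proof.
move=> fx x0; apply: L0P.
have /Lnorm_eq0_eq0 : ('N[mu]_p[EFin \o (x : T -> R)] = 0)%E.
  by rewrite in_LpE// x0.
have A := @L0_zeroE _ _ _ mu.
move=> /(_ _ (lt_le_trans lte01 p1)) B.
have {}B := B (iffRL (measurable_EFinP _ _) (measurable_L0 x)).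
by apply: filterS2 A B => t A /(_ I) [->]; rewrite A.
Qed.

End fixed_exponent.
End Lnorm_ae.
#[global] Hint Resolve measurable_L0 : core.

Section Lcap.
Context d (T : measurableType d) (R : realType).
Context (mu : {measure set T -> \bar R}).
Context (p : \bar R) (p1 : (1 <= p)%E).
Local Notation L0 := {mfun_ mu, T >-> R}.

Let y1 : (1 <= +oo :> \bar R)%E := leey 1.

Definition Lcap : {pred L0} :=
  [pred x : L0 | `[< in_Lp p x /\ in_Lp +oo x >] ].

Lemma Lcap_submod_closed : submod_closed Lcap.
Proof.
split; first by apply/asboolP; split; exact: in_Lp0.
move=> a x y /asboolP[xp xy] /asboolP[yp yy].
by apply/asboolP; split; apply: in_LpD => //; exact: in_LpZ.
Qed.

Definition Lcap_norm (x : L0) : R := Num.max (L0norm p x) (L0norm +oo x).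

End Lcap.

Record LpCapLoo d (T : measurableType d) (R : realType)
    (mu : {measure set T -> \bar R}) (p : \bar R) (p1 : (1 <= p)%E) :=
  MkLpCapLoo {
  Lcap_val :> {mfun_ mu, T >-> R} ;
  Lcap_valP : Lcap_val \in Lcap p }.

Section LpCapLoo.
Context d (T : measurableType d) (R : realType).
Context (mu : {measure set T -> \bar R}).
Context (p : \bar R) (p1 : (1 <= p)%E).
Local Notation Lcap := (LpCapLoo mu p1).

HB.instance Definition _ := [isSub for @Lcap_val _ _ _ mu _ p1].
HB.instance Definition _ := [Choice of Lcap by <:].
HB.instance Definition _ := GRing.SubChoice_isSubLmodule.Build R _ _ Lcap
  (Lcap_submod_closed mu p1).

Let norm (x : Lcap) : R := Lcap_norm p (val x).

Let in_p (x : Lcap) : in_Lp p (Lcap_val x).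
Proof. by have /asboolP[] := Lcap_valP x. Qed.

Let in_y (x : Lcap) : in_Lp +oo (Lcap_val x).
Proof. by have /asboolP[] := Lcap_valP x. Qed.

Let normD x y : norm (x + y) <= norm x + norm y.
Proof.
rewrite /norm/Lcap_norm raddfD ge_max; apply/andP; split.
- apply: le_trans (L0normD p1 (in_p x) (in_p y)) _.
  by rewrite lerD// le_max lexx ?orbT.
- apply: le_trans (L0normD (leey 1) (in_y x) (in_y y)) _.
  by rewrite lerD// le_max lexx ?orbT.
Qed.

Let normZ a x : norm (a *: x) = `|a| * norm x.
Proof. by rewrite /norm/Lcap_norm linearZ/= !L0normZ// ?leey// maxr_pMr. Qed.

Let norm_eq0 x : norm x = 0 -> x = 0.
Proof.
move=> x0; apply: val_inj; rewrite raddf0; apply: (L0norm_eq0 p1 (in_p x)).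
by apply/eqP; rewrite eq_le L0norm_ge0 andbT -x0 le_max lexx.
Qed.

HB.instance Definition _ :=
  Lmodule_isNormed.Build R Lcap normD normZ norm_eq0.

End LpCapLoo.

Section Lsum.
Context d (T : measurableType d) (R : realType).
Context (mu : {measure set T -> \bar R}).
Context (p : \bar R) (p1 : (1 <= p)%E).
Local Notation L0 := {mfun_ mu, T >-> R}.

Let y1 : (1 <= +oo :> \bar R)%E := leey 1.

Definition Lsum_dec (x u v : L0) : Prop :=
  [/\ in_Lp p u, in_Lp +oo v & x = u + v].

Definition Lsum : {pred L0} :=
  [pred x : L0 | `[< exists u v, Lsum_dec x u v >] ].

Definition Lsum_norm (x : L0) : R :=
  inf [set s | exists u v, Lsum_dec x u v /\ s = L0norm p u + L0norm +oo v].

Lemma Lsum_dec0 : Lsum_dec 0 0 0.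
Proof. by split; rewrite ?addr0//; exact: in_Lp0. Qed.

Lemma Lsum_decD x y u v u' v' : Lsum_dec x u v -> Lsum_dec y u' v' ->
  Lsum_dec (x + y) (u + u') (v + v').
Proof.
move=> [up vy ->] [up' vy' ->]; split; [exact: in_LpD|exact: in_LpD|].
by rewrite addrACA.
Qed.

Lemma Lsum_decZ a x u v : Lsum_dec x u v ->
  Lsum_dec (a *: x) (a *: u) (a *: v).
Proof.
by move=> [up vy ->]; split; rewrite ?scalerDr//; exact: in_LpZ.
Qed.

Lemma Lsum_submod_closed : submod_closed Lsum.
Proof.
split; first by apply/asboolP; exists 0, 0; exact: Lsum_dec0.
move=> a x y /asboolP[u [v xuv]] /asboolP[u' [v' yuv]].
apply/asboolP; exists (a *: u + u'), (a *: v + v').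
by apply: Lsum_decD => //; exact: Lsum_decZ.
Qed.

Lemma Lsum_norm_le x u v : Lsum_dec x u v ->
  Lsum_norm x <= L0norm p u + L0norm +oo v.
Proof.
move=> xuv; apply: ge_inf; last by exists u, v.
by exists 0 => _ [u' [v' [_ ->]]]; rewrite addr_ge0 ?L0norm_ge0.
Qed.

Lemma le_Lsum_norm c x : x \in Lsum ->
    (forall u v, Lsum_dec x u v -> c <= L0norm p u + L0norm +oo v) ->
  c <= Lsum_norm x.
Proof.
move=> /asboolP[u [v xuv]] H; apply: lb_le_inf.
  by exists (L0norm p u + L0norm +oo v), u, v.
by move=> _ [u' [v' [d' ->]]]; exact: H.
Qed.

Lemma Lsum_normD x y : x \in Lsum -> y \in Lsum ->
  Lsum_norm (x + y) <= Lsum_norm x + Lsum_norm y.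
Proof.
move=> xS yS; rewrite -lerBlDr; apply: le_Lsum_norm => // u v xuv.
rewrite lerBlDr -lerBlDl; apply: le_Lsum_norm => // u' v' yuv.
rewrite lerBlDl (le_trans (Lsum_norm_le (Lsum_decD xuv yuv)))//.
case: xuv yuv => up vy _ [up' vy' _].
by rewrite addrACA lerD// L0normD.
Qed.

Let Lsum_normZ_le a x : x \in Lsum -> a != 0 ->
  Lsum_norm (a *: x) <= `|a| * Lsum_norm x.
Proof.
move=> xS a0; rewrite mulrC -ler_pdivrMr ?normr_gt0//.
apply: le_Lsum_norm => // u v xuv; rewrite ler_pdivrMr ?normr_gt0//.
apply: le_trans (Lsum_norm_le (Lsum_decZ a xuv)) _.
by case: xuv => up vy _; rewrite !L0normZ// mulrDl ![_ * `|a|]mulrC.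
Qed.

Lemma Lsum_norm_ge0 x : x \in Lsum -> 0 <= Lsum_norm x.
Proof.
by move=> xS; apply: le_Lsum_norm => // u v _; rewrite addr_ge0 ?L0norm_ge0.
Qed.

Lemma Lsum_normZ a x : x \in Lsum -> Lsum_norm (a *: x) = `|a| * Lsum_norm x.
Proof.
move=> xS; have aS : a *: x \in Lsum.
  move/asboolP: xS => [u [v /(Lsum_decZ a) xuv]].
  by apply/asboolP; exists (a *: u), (a *: v).
have [a0|a0] := eqVneq a 0.
  apply/eqP; rewrite eq_le a0 normr0 mul0r scale0r; apply/andP; split.
    apply: le_trans (Lsum_norm_le Lsum_dec0) _.
    by rewrite -(scale0r 0) !L0normZ ?normr0 ?mul0r ?addr0//; exact: in_Lp0.
  by apply: Lsum_norm_ge0; rewrite -(scale0r x) -a0.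
apply/eqP; rewrite eq_le Lsum_normZ_le//= -ler_pdivlMl ?normr_gt0//.
by rewrite -normfV -[in leLHS](scalerK a0 x) Lsum_normZ_le// invr_eq0.
Qed.

Lemma Lsum_norm_eq0 x : x \in Lsum -> Lsum_norm x = 0 -> x = 0.
Proof.
move=> xS x0.
pose w (e : R) (t : T) : R := Num.max 0 (`|x t| - e).
have mw e : measurable_fun setT (w e).
  apply: measurable_maxr; first exact: measurable_cst.
  by apply: measurable_funB => //; exact: measurableT_comp.
have wge0 e t : 0 <= w e t by rewrite le_max lexx.
have small e : 0 < e -> ('N[mu]_p[EFin \o w e] <= e%:E)%E.
  move=> e0; have : ~ (e <= Lsum_norm x) by rewrite x0 leNgt e0.
  move/(contra_not (le_Lsum_norm xS)) => /existsNP[u] /existsNP[v].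
  move=> /not_implyP[[up vy xuv] /negP]; rewrite -ltNge => uve.
  apply: (@le_trans _ _ (L0norm p u)%:E); last first.
    by rewrite lee_fin (le_trans _ (ltW uve))// lerDl L0norm_ge0.
  rewrite -in_LpE//; apply: le_Lnorm_ae => //.
  have A := ae_le_Lnormy mu (measurable_L0 v).
  have B := L0_addE u v.
  apply: filterS2 A B => t; rewrite in_LpE// lee_fin => A B.
  rewrite (ger0_norm (wge0 _ _)) /w ge_max normr_ge0/= lerBlDr xuv.
  rewrite [X in `|X|]B (le_trans (ler_normD _ _))// lerD2l (le_trans A)//.
  by rewrite (le_trans _ (ltW uve))// lerDr L0norm_ge0.
have w0 e : 0 < e -> \forall t \ae mu, w e t = 0.
  move=> e0; suff : ('N[mu]_p[EFin \o w e] = 0)%E.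
    move/Lnorm_eq0_eq0 => /(_ _ (lt_le_trans lte01 p1)) => /(_ _).
    move=> H; have := H (iffRL (measurable_EFinP _ _) (mw e)).
    by apply: filterS => t /(_ I) [].
  apply/eqP; rewrite eq_le Lnorm_ge0 andbT; apply/lee_addgt0Pr => d' d0.
  rewrite add0e; have m0 : 0 < Num.min d' e by rewrite lt_min d0.
  apply: (@le_trans _ _ ('N[mu]_p[EFin \o w (Num.min d' e)])%E).
    apply: le_Lnorm_ae => //; apply: nearW => t.
    rewrite !(ger0_norm (wge0 _ _)) /w ge_max !le_max lexx/= lerB ?orbT//.
    by rewrite ge_min lexx orbT.
  by rewrite (le_trans (small _ m0))// lee_fin ge_min lexx.
apply: L0P; have A := @L0_zeroE _ _ _ mu.
have /ae_foralln B : forall n, \forall t \ae mu, w n.+1%:R^-1 t = 0.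
  by move=> n; apply: w0; rewrite invr_gt0.
apply: filterS2 A B => t -> B; apply/eqP; rewrite -normr_le0.
apply/ler_addgt0Pr => e e0; rewrite add0r.
have [n _ ne] := near_infty_natSinv_lt (PosNum e0).
have := ne n (leqnn n) => /= /ltW; apply: le_trans.
by rewrite -subr_le0 -(B n) /w le_max lexx orbT.
Qed.

End Lsum.

Record LpPlusLoo d (T : measurableType d) (R : realType)
    (mu : {measure set T -> \bar R}) (p : \bar R) (p1 : (1 <= p)%E) :=
  MkLpPlusLoo {
  Lsum_val :> {mfun_ mu, T >-> R} ;
  Lsum_valP : Lsum_val \in Lsum p }.

Section LpPlusLoo.
Context d (T : measurableType d) (R : realType).
Context (mu : {measure set T -> \bar R}).
Context (p : \bar R) (p1 : (1 <= p)%E).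
Local Notation Lsum := (LpPlusLoo mu p1).

HB.instance Definition _ := [isSub for @Lsum_val _ _ _ mu _ p1].
HB.instance Definition _ := [Choice of Lsum by <:].
HB.instance Definition _ := GRing.SubChoice_isSubLmodule.Build R _ _ Lsum
  (Lsum_submod_closed mu p1).

Let norm (x : Lsum) : R := Lsum_norm p (val x).

Let normD x y : norm (x + y) <= norm x + norm y.
Proof.
by rewrite /norm raddfD; apply: Lsum_normD p1 _ _ _ _; exact: Lsum_valP.
Qed.

Let normZ a x : norm (a *: x) = `|a| * norm x.
Proof.
by rewrite /norm linearZ; apply: Lsum_normZ p1 _ _ _; exact: Lsum_valP.
Qed.

Let norm_eq0 x : norm x = 0 -> x = 0.
Proof.
move=> x0; apply: val_inj; rewrite raddf0.
exact: Lsum_norm_eq0 p1 _ (Lsum_valP x) x0.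
Qed.

HB.instance Definition _ :=
  Lmodule_isNormed.Build R Lsum normD normZ norm_eq0.

End LpPlusLoo.

Lemma LpCapLoo_normE d (T : measurableType d) (R : realType)
    (mu : {measure set T -> \bar R}) (p : \bar R) (p1 : (1 <= p)%E)
    (x : LpCapLoo mu p1) :
  `|x| = Num.max (L0norm p (val x)) (L0norm +oo (val x)).
Proof. by []. Qed.

Lemma LpPlusLoo_normE d (T : measurableType d) (R : realType)
    (mu : {measure set T -> \bar R}) (p : \bar R) (p1 : (1 <= p)%E)
    (x : LpPlusLoo mu p1) :
  `|x| = inf [set s | exists u v : {mfun_ mu, T >-> R},
    [/\ in_Lp p u, in_Lp +oo v & val x = u + v] /\
    s = L0norm p u + L0norm +oo v].
Proof. by []. Qed.

Lemma measurable_half_line (R : realType) :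
  ((@wlength R idfun)^*)%mu.-cara.-measurable `]0%R, +oo[%classic.
Proof.
apply: (sub_caratheodory (@wlength R idfun)).
exact: (@measurable_itv R `]0, +oo[).
Qed.

(* Lebesgue measure on ]0, +oo[, on the sigma-algebra of Lebesgue measurable
   sets. It is carried by the whole line but gives measure 0 to ]-oo, 0], so
   that modulo a.e. equality a function on the line is the same thing as its
   restriction to ]0, +oo[. *)
Definition half_line_measure (R : realType) : {measure set _ -> \bar R} :=
  mrestr (@completed_lebesgue_measure R) (@measurable_half_line R).

Definition isomorphic (R : realType) (V W : normedModType R) : Prop :=
  exists (f : {linear V -> W}) (g : {linear W -> V}),
    [/\ cancel f g, cancel g f,
        exists C : R, forall x, `|f x| <= C * `|x| &
        exists C : R, forall y, `|g y| <= C * `|y|].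

(* Main.v *)
Require Import Defs.
From HB Require Import structures.
From mathcomp Require Import all_boot all_order all_algebra.
From mathcomp Require Import all_classical all_reals all_analysis.
From mathcomp Require Import ring lra zify measurable_realfun ess_sup_inf.
Set Implicit Arguments.
Unset Strict Implicit.
Unset Printing Implicit Defensive.
Import Order.TTheory GRing.Theory Num.Theory.
Import numFieldNormedType.Exports.
Local Open Scope ring_scope.

Remove Hints measurable_L0 : core.

(** Write [X] for the intersection and [Y] for the sum of [L_p] and [L_infty].
    On a set [J] of measure one the sum is just [L_p], and it contains the Walsh
    functions [w n], a bounded orthonormal system. An isomorphism between [Y]
    and [X] turns them into functions [x n] of [X] with biorthogonal functionals
    [b n]. The functions supported in a set of finite measure form, inside [X], a
    copy of [L_infty], and operators from [L_infty] to a Hilbert space are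
    2-summing: this is the little Grothendieck inequality
    ([little_grothendieck]), whose proof is the classical truncation argument
    with random signs. It shows that the part of [x n] carried by a set of finite
    measure contributes little, on average over a long range of indices, to the
    pairing of [b n] with [x n], although this pairing is one.

    Thus the mass of the [x n] escapes to infinity. What escapes cannot be
    small in [L_p]: a bounded function with a small [L_p] norm is, up to a small
    error, carried by a set of small measure, and for a whole block of indices
    the union of these sets has measure at most one, so that the inequality
    applies again. So one finds humps ([hump_exists]): restrictions of the
    [x n] to disjoint sets ([hump_sequence]), on which both the [L_p] norm and the
    pairing with [b n] stay away from zero.

    Disjoint humps behave like the basis of [l_p], whereas orthonormality makes
    the [x n] and the [b n] behave on average like the basis of [l_2]. For
    [p < 2], the random sums of [K] of the [x n] have norm at most of order
    [K ^ (1/2)], but the humps force at least the order [K ^ (1/p)]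
    ([no_humps_lt2]). For [2 < p], the sums of the humps have norm at most
    [K ^ (1/p)] and those of the [b n] at most [K ^ (1/2)], yet their pairing has
    order [K] ([no_humps_gt2]). Both are contradictions when [K] is large.

    For [p = 1] the functionals [b n] come from functions in [L_infty] only, and
    random sums of an arbitrary choice of [N] Walsh functions may have a supremum
    of order [N]. This is why the argument works with blocks of consecutive
    Walsh functions: on a block of [N] indices they depend, up to a common
    factor, on [N] points only, so that by a fourth moment estimate the supremum
    is of order [N ^ (3/4)] on average ([mean_block_sup]). *)

(** * Random signs *)

Section random_signs.
Context (R : realFieldType) (I : finType).
Implicit Types (e : {ffun I -> bool}) (g h : {ffun I -> bool} -> R).

Definition sgn e (i : I) : R := (-1) ^+ e i.

Definition mean g : R := (\sum_e g e) / 2 ^+ #|I|.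

Let two_gt0 : (0 : R) < 2 ^+ #|I|. Proof. by rewrite exprn_gt0. Qed.

Lemma meanD g h : mean (fun e => g e + h e) = mean g + mean h.
Proof. by rewrite /mean big_split mulrDl. Qed.

Lemma meanZ c g : mean (fun e => c * g e) = c * mean g.
Proof. by rewrite /mean -mulr_sumr mulrA. Qed.

Lemma mean_sum (J : finType) (g : J -> {ffun I -> bool} -> R) :
  mean (fun e => \sum_j g j e) = \sum_j mean (g j).
Proof. by rewrite /mean exchange_big mulr_suml. Qed.

Lemma mean_cst c : mean (fun=> c) = c.
Proof.
rewrite /mean sumr_const card_ffun card_bool -[_ *+ (_ ^ _)]mulr_natr natrX.
by rewrite mulfK// gt_eqF.
Qed.

Lemma le_mean g h : (forall e, g e <= h e) -> mean g <= mean h.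
Proof. by move=> gh; rewrite ler_pM2r ?invr_gt0// ler_sum. Qed.

Lemma eq_mean g h : g =1 h -> mean g = mean h.
Proof. by move=> gh; rewrite /mean; congr (_ / _); apply: eq_bigr. Qed.

Lemma mean_ge0 g : (forall e, 0 <= g e) -> 0 <= mean g.
Proof. by move=> g0; rewrite -(mean_cst 0) le_mean. Qed.

(** Reversing one sign preserves the mean; so a quantity that changes sign
    under this operation has mean zero. *)
Definition flip (i : I) e : {ffun I -> bool} := [ffun j => (j == i) (+) e j].

Lemma flipK i : involutive (flip i).
Proof. by move=> e; apply/ffunP => j; rewrite !ffunE addbA addbb. Qed.

Lemma sgn_flip i e j : sgn (flip i e) j = (-1) ^+ (j == i) * sgn e j.
Proof. by rewrite /sgn ffunE signr_addb. Qed.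

Lemma sgn_flip_eq i e : sgn (flip i e) i = - sgn e i.
Proof. by rewrite sgn_flip eqxx expr1 mulN1r. Qed.

Lemma sgn_flip_neq i e j : j != i -> sgn (flip i e) j = sgn e j.
Proof. by move=> /negbTE ji; rewrite sgn_flip ji mul1r. Qed.

Lemma sgnM e i : sgn e i * sgn e i = 1.
Proof. by rewrite /sgn -signr_addb addbb. Qed.

Lemma normr_sgn e i : `|sgn e i| = 1.
Proof. by rewrite /sgn normrX normrN1 expr1n. Qed.

Lemma mean_flip i g : mean (fun e => g (flip i e)) = mean g.
Proof.
by rewrite /mean [in RHS](reindex_inj (inv_inj (flipK i))).
Qed.

Lemma mean_odd i g : (forall e, g (flip i e) = - g e) -> mean g = 0.
Proof.
move=> gN; suff : mean g = - mean g by lra.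
rewrite -{1}(mean_flip i) -mulN1r -meanZ.
by apply: eq_mean => e; rewrite gN mulN1r.
Qed.

Lemma mean_sgnM i j : mean (fun e => sgn e i * sgn e j) = (i == j)%:R.
Proof.
have [->|ij] := eqVneq i j.
  by rewrite -[RHS](mean_cst 1); apply: eq_mean => e; rewrite sgnM.
apply: (@mean_odd i) => e.
by rewrite sgn_flip_eq sgn_flip_neq 1?eq_sym// mulNr.
Qed.

(** Summing one index at a time, only the even powers of the new term survive
    in the mean, its odd powers being reversed by the flip of that sign. *)
Lemma mean_sgn_sum_moments (a : I -> R) (s : seq I) : uniq s ->
  let F e := \sum_(i <- s) a i * sgn e i in
  let v := \sum_(i <- s) a i ^+ 2 in
  mean (fun e => F e ^+ 2) = v /\ mean (fun e => F e ^+ 4) <= 3 * v ^+ 2.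
Proof.
elim: s => [_|i s IH /= /andP[i_s us]].
  rewrite /=; under eq_mean do rewrite big_nil expr0n.
  rewrite mean_cst big_nil; split=> //.
  by under eq_mean do rewrite big_nil expr0n; rewrite mean_cst expr0n mulr0.
have [F2 F4] := IH us.
set F := fun e => \sum_(i <- s) a i * sgn e i in F2 F4 *.
set v := \sum_(i <- s) a i ^+ 2 in F2 F4 *.
have Fi e : F (flip i e) = F e.
  rewrite /F; apply: eq_big_seq => j js; rewrite sgn_flip_neq//.
  by apply: contraNneq i_s => <-.
have v0 : 0 <= v by apply: sumr_ge0 => j _; exact: sqr_ge0.
have odd1 : mean (fun e => F e * sgn e i) = 0.
  by apply: (@mean_odd i) => e; rewrite Fi sgn_flip_eq mulrN.
have odd3 : mean (fun e => F e ^+ 3 * sgn e i) = 0.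
  by apply: (@mean_odd i) => e; rewrite Fi sgn_flip_eq mulrN.
split.
- under eq_mean => e.
    rewrite big_cons -/(F e).
    have -> : (a i * sgn e i + F e) ^+ 2 =
        a i ^+ 2 + (F e ^+ 2 + (a i *+ 2) * (F e * sgn e i)).
      have e2 : sgn e i ^+ 2 = 1 by rewrite expr2 sgnM.
      transitivity (a i ^+ 2 * sgn e i ^+ 2
        + (F e ^+ 2 + (a i *+ 2) * (F e * sgn e i))); first by ring.
      by rewrite e2 mulr1.
    over.
  by rewrite !meanD mean_cst meanZ odd1 mulr0 addr0 F2 big_cons.
- under eq_mean => e.
    rewrite big_cons -/(F e).
    have -> : (a i * sgn e i + F e) ^+ 4 = (a i ^+ 4 + (6 * a i ^+ 2) * F e ^+ 2)
       + (F e ^+ 4 + ((4 * a i) * (F e ^+ 3 * sgn e i)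
         + (4 * a i ^+ 3) * (F e * sgn e i))).
      have e2 : sgn e i ^+ 2 = 1 by rewrite expr2 sgnM.
      have e3 : sgn e i ^+ 3 = sgn e i by rewrite exprS e2 mulr1.
      have e4 : sgn e i ^+ 4 = 1 by rewrite exprS e3 -expr2 e2.
      transitivity (a i ^+ 4 * sgn e i ^+ 4 + 6 * a i ^+ 2 * F e ^+ 2 * sgn e i ^+ 2
         + F e ^+ 4 + 4 * a i * F e ^+ 3 * sgn e i
         + 4 * a i ^+ 3 * F e * sgn e i ^+ 3); first by ring.
      by rewrite e2 e3 e4; ring.
    over.
  rewrite !meanD mean_cst !meanZ odd1 odd3 !mulr0 !addr0 F2 big_cons -/v.
  have := sqr_ge0 (a i ^+ 2); nra.
Qed.

Lemma mean_sgn_sum_sqr (a : I -> R) :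
  mean (fun e => (\sum_i a i * sgn e i) ^+ 2) = \sum_i a i ^+ 2.
Proof. exact: (mean_sgn_sum_moments a (index_enum_uniq I)).1. Qed.

Lemma mean_sgn_sum_pow4 (a : I -> R) :
  mean (fun e => (\sum_i a i * sgn e i) ^+ 4) <= 3 * (\sum_i a i ^+ 2) ^+ 2.
Proof. exact: (mean_sgn_sum_moments a (index_enum_uniq I)).2. Qed.

Lemma bessel_sgn g :
  \sum_i (mean (fun e => sgn e i * g e)) ^+ 2 <= mean (fun e => g e ^+ 2).
Proof.
pose c i := mean (fun e => sgn e i * g e).
have : 0 <= mean (fun e => (g e - \sum_i c i * sgn e i) ^+ 2).
  by apply: mean_ge0 => e; exact: sqr_ge0.
under eq_mean => e.
  have -> : (g e - \sum_i c i * sgn e i) ^+ 2 = g e ^+ 2 +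
      ((\sum_i c i * sgn e i) ^+ 2 + (- 2) * \sum_i c i * (sgn e i * g e)).
    have -> : \sum_i c i * (sgn e i * g e) = (\sum_i c i * sgn e i) * g e.
      by rewrite mulr_suml; apply: eq_bigr => i _; rewrite mulrA.
    by ring.
  over.
rewrite !meanD meanZ mean_sgn_sum_sqr mean_sum.
have -> : \sum_j mean (fun e => c j * (sgn e j * g e)) = \sum_i c i ^+ 2.
  by apply: eq_bigr => i _; rewrite meanZ expr2.
rewrite -/c; lra.
Qed.

(** Flipping the sign of one term moves the sum by twice that term, so one of
    the two sums is at least as large as the term. *)
Lemma mean_ge_term (phi : R -> R) (a : I -> R) i : (forall x, 0 <= phi x) ->
    {in Num.nneg &, {homo phi : x y / x <= y}} ->
  phi `|a i| <= 2 * mean (fun e => phi `|\sum_j a j * sgn e j|).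
Proof.
move=> phi0 phi_nd; pose F e := \sum_j a j * sgn e j.
have -> : 2 * mean (fun e => phi `|F e|) =
    mean (fun e => phi `|F e| + phi `|F (flip i e)|).
  by rewrite meanD (mean_flip i (fun e => phi `|F e|)); ring.
rewrite -[leLHS]mean_cst; apply: le_mean => e.
have FB : F e - F (flip i e) = 2 * (a i * sgn e i).
  rewrite /F (bigD1 i)//= [X in _ - X](bigD1 i)//= sgn_flip_eq.
  have -> : \sum_(j | j != i) a j * sgn (flip i e) j =
            \sum_(j | j != i) a j * sgn e j.
    by apply: eq_bigr => j ji; rewrite sgn_flip_neq.
  by ring.
have : `|F e - F (flip i e)| = 2 * `|a i|.
  by rewrite FB !normrM normr_sgn mulr1 ger0_norm.
have := ler_normB (F e) (F (flip i e)).
have [h1 h2 h3|h1 h2 h3] := leP `|a i| `|F e|.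
  by rewrite ler_wpDr// phi_nd// nnegrE.
have {}h1 : `|a i| <= `|F (flip i e)| by lra.
by rewrite ler_wpDl// phi_nd// nnegrE.
Qed.

End random_signs.


(** * Functions in the intersection space *)

(** The [p]-th power of the [L_p] norm. It is used in place of the norm because
    it is additive over disjoint supports. *)
HB.lock Definition Ip d (T : measurableType d) (R : realType)
    (mu : {measure set T -> \bar R}) (p : R) (g : T -> R) : \bar R :=
  (\int[mu]_t (`|g t| `^ p)%:E)%E.

Section cap_functions.
Local Open Scope classical_set_scope.
Context d (T : measurableType d) (R : realType).
Context (mu : {measure set T -> \bar R}) (p : R) (p1 : 1 <= p).
Implicit Types (g h : T -> R) (a c : R).

Let p0 : 0 < p. Proof. exact: lt_le_trans ltr01 p1. Qed.

Local Notation Ip := (Ip mu p).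

(** Bounds are imposed at every point, not almost everywhere, so that all the
    truncations below can be carried out pointwise. *)
Definition cap_ball a g : Prop :=
  [/\ measurable_fun setT g, forall t, `|g t| <= a & (Ip g <= (a `^ p)%:E)%E].

Definition in_cap g : Prop := exists a, cap_ball a g.

Lemma measurable_powR_norm g : measurable_fun setT g ->
  measurable_fun setT (fun t => (`|g t| `^ p)%:E).
Proof.
move=> mg; apply/measurable_EFinP.
apply: (@measurableT_comp _ _ _ _ _ _ (@powR R ^~ p)) => //.
exact: measurableT_comp.
Qed.

Lemma Ip_ge0 g : (0 <= Ip g)%E.
Proof. by rewrite Ip.unlock; apply: integral_ge0 => t _; rewrite lee_fin powR_ge0. Qed.

Lemma le_Ip g h : measurable_fun setT g -> measurable_fun setT h ->
  (forall t, `|g t| <= `|h t|) -> (Ip g <= Ip h)%E.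
Proof.
move=> mg mh gh; rewrite Ip.unlock; apply: ge0_le_integral => //.
- exact: measurable_powR_norm.
- exact: measurable_powR_norm.
- by move=> t _; rewrite lee_fin ge0_ler_powR ?nnegrE ?(ltW p0).
Qed.

Lemma IpZ c g : measurable_fun setT g ->
  Ip (fun t => c * g t) = ((`|c| `^ p)%:E * Ip g)%E.
Proof.
move=> mg; rewrite Ip.unlock -ge0_integralZl_EFin ?powR_ge0//.
- by apply: eq_integral => t _; rewrite normrM powRM// EFinM.
- exact: measurable_powR_norm.
Qed.

Lemma Ip_add_le g h : measurable_fun setT g -> measurable_fun setT h ->
  (Ip (fun t => (g t + h t)%R) <= (2 `^ p)%:E * (Ip g + Ip h))%E.
Proof.
move=> mg mh; rewrite Ip.unlock -ge0_integralD//; last 2 first.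
- exact: measurable_powR_norm.
- exact: measurable_powR_norm.
rewrite -ge0_integralZl_EFin ?powR_ge0//; last 2 first.
- by move=> t _; rewrite adde_ge0// lee_fin powR_ge0.
- by apply: emeasurable_funD; exact: measurable_powR_norm.
apply: ge0_le_integral => //.
- by apply: measurable_powR_norm; exact: measurable_funD.
- apply: emeasurable_funM => //.
  by apply: emeasurable_funD; exact: measurable_powR_norm.
move=> t _; rewrite -EFinD -EFinM lee_fin mulrDr -!powRM//.
have gh := ler_normD (g t) (h t).
have [le|le] := leP `|g t| `|h t|.
  apply: ler_wpDl; first exact: powR_ge0.
  by rewrite ge0_ler_powR ?nnegrE ?mulr_ge0 ?(ltW p0)//; lra.
apply: ler_wpDr; first exact: powR_ge0.
by rewrite ge0_ler_powR ?nnegrE ?mulr_ge0 ?(ltW p0)//; lra.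
Qed.

Lemma cap_ball_ge0 a g : cap_ball a g -> T -> 0 <= a.
Proof. by move=> [_ ga _] t; rewrite (le_trans _ (ga t)). Qed.

(** The exponent [p^-1] turns a finite integral into the radius of a ball. *)
Lemma in_capP g : in_cap g <->
  [/\ measurable_fun setT g, exists a, forall t, `|g t| <= a & (Ip g < +oo)%E].
Proof.
split=> [[a [mg ga Ia]]|[mg [a ga] Ig]].
  by split; [|exists a|rewrite (le_lt_trans Ia)// ltry].
have If : Ip g \is a fin_num by rewrite ge0_fin_numE// Ip_ge0.
exists (Num.max a ((fine (Ip g)) `^ p^-1)); split=> // [t|].
  by rewrite (le_trans (ga t))// le_max lexx.
rewrite -[leLHS]fineK// lee_fin.
have fI0 : 0 <= fine (Ip g) by rewrite fine_ge0// Ip_ge0.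
rewrite -[leLHS](powRr1 fI0) -(mulVf (lt0r_neq0 p0)) powRrM.
by rewrite ge0_ler_powR ?nnegrE ?(ltW p0)// ?le_max ?powR_ge0 ?orbT// lexx orbT.
Qed.

Lemma in_cap_measurable g : in_cap g -> measurable_fun setT g.
Proof. by case=> a []. Qed.

Lemma cap_ball_le a g h : cap_ball a h -> measurable_fun setT g ->
  (forall t, `|g t| <= `|h t|) -> cap_ball a g.
Proof.
move=> [mh ha Ih] mg gh; split=> // [t|]; first exact: le_trans (ha t).
by apply: le_trans Ih; exact: le_Ip.
Qed.

Lemma in_cap_le g h : in_cap h -> measurable_fun setT g ->
  (forall t, `|g t| <= `|h t|) -> in_cap g.
Proof. by move=> [a ha] mg gh; exists a; exact: cap_ball_le gh. Qed.

Lemma in_capD g h : in_cap g -> in_cap h -> in_cap (fun t => g t + h t).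
Proof.
move=> /in_capP[mg [a ga] Ig] /in_capP[mh [b hb] Ih]; apply/in_capP; split.
- exact: measurable_funD.
- by exists (a + b) => t; rewrite (le_trans (ler_normD _ _))// lerD.
- rewrite (le_lt_trans (Ip_add_le mg mh))// lte_mul_pinfty ?lee_fin ?powR_ge0//.
  by rewrite lte_add_pinfty.
Qed.

Lemma in_capZ c g : in_cap g -> in_cap (fun t => c * g t).
Proof.
move=> /in_capP[mg [a ga] Ig]; apply/in_capP; split.
- exact: measurable_funM.
- by exists (`|c| * a) => t; rewrite normrM ler_wpM2l.
- by rewrite IpZ// lte_mul_pinfty ?lee_fin ?powR_ge0.
Qed.

Lemma in_capB g h : in_cap g -> in_cap h -> in_cap (fun t => g t - h t).
Proof.
move=> hg hh; have -> : (fun t => g t - h t) = (fun t => g t + -1 * h t).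
  by apply/funext => t; rewrite mulN1r.
exact: in_capD hg (in_capZ (-1) hh).
Qed.

Lemma in_cap0 : in_cap (fun=> 0).
Proof.
exists 0; split=> // [t|]; first by rewrite normr0.
rewrite Ip.unlock; under eq_integral do rewrite normr0 powR0 ?gt_eqF//.
by rewrite integral0 lee_fin powR_ge0.
Qed.

Lemma in_cap_sum (J : Type) (s : seq J) (f : J -> T -> R) :
  (forall j, in_cap (f j)) -> in_cap (fun t => \sum_(j <- s) f j t).
Proof.
move=> hf; elim: s => [|j s IH].
  by under eq_fun do rewrite big_nil; exact: in_cap0.
by under eq_fun do rewrite big_cons; exact: in_capD.
Qed.

Lemma in_cap_indic D g : measurable D -> in_cap g ->
  in_cap (fun t => \1_D t * g t).
Proof.
move=> mD hg; apply: (in_cap_le hg).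
  by apply: measurable_funM => //; exact: in_cap_measurable.
by move=> t; rewrite normrM indicE; case: (t \in D);
  rewrite ?normr1 ?mul1r// normr0 mul0r.
Qed.

Lemma cap_ball_indic a D g : measurable D -> cap_ball a g ->
  cap_ball a (fun t => \1_D t * g t).
Proof.
move=> mD hg; apply: (cap_ball_le hg).
  by case: hg => mg _ _; apply: measurable_funM.
by move=> t; rewrite normrM indicE; case: (t \in D);
  rewrite ?normr1 ?mul1r// normr0 mul0r.
Qed.

(** On a set of finite measure bounded functions belong to the intersection. As
    [1 <= A] and [1 <= p], the factor [A] dominates [A `^ p^-1]. *)
Lemma cap_ball_supp D A M g : measurable D -> (mu D <= A%:E)%E -> 1 <= A ->
  0 <= M -> measurable_fun setT g -> (forall t, `|g t| <= M) ->
  (forall t, ~ D t -> g t = 0) -> cap_ball (A * M) g.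
Proof.
move=> mD DA A1 M0 mg gM gD; split=> // [t|].
  by rewrite (le_trans (gM t))// ler_peMl.
rewrite powRM ?(le_trans _ A1)//.
have -> : Ip g = (\int[mu]_(t in D) (`|g t| `^ p)%:E)%E.
  rewrite Ip.unlock [RHS]integral_mkcond; apply: eq_integral => t _; rewrite patchE.
  by case: ifPn => // /negP; rewrite inE => /gD ->; rewrite normr0 powR0 ?gt_eqF.
apply: (@le_trans _ _ (\int[mu]_(t in D) (cst (M `^ p)%:E) t)%E).
  apply: ge0_le_integral => //.
  - apply: measurable_funTS; exact: measurable_powR_norm.
  - by move=> t _; rewrite lee_fin ge0_ler_powR ?nnegrE ?(ltW p0).
rewrite integral_cst// muleC EFinM lee_wpmul2r ?lee_fin ?powR_ge0//.
by rewrite (le_trans DA)// lee_fin le1r_powR.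
Qed.

(** * Linear functionals and a little Grothendieck inequality *)

Record cap_linear (b : (T -> R) -> R) : Prop := CapLinear {
  cap_linD : forall g h, in_cap g -> in_cap h ->
    b (fun t => g t + h t) = b g + b h ;
  cap_linZ : forall c g, in_cap g -> b (fun t => c * g t) = c * b g }.

Lemma cap_lin0 b : cap_linear b -> b (fun=> 0) = 0.
Proof.
move=> lb; have -> : (fun=> 0) = (fun t : T => 0 * (0 : R)).
  by apply/funext => t; rewrite mul0r.
by rewrite (cap_linZ lb 0 in_cap0) mul0r.
Qed.

Lemma cap_lin_sum b (J : Type) (s : seq J) (f : J -> T -> R) :
  cap_linear b -> (forall j, in_cap (f j)) ->
  b (fun t => \sum_(j <- s) f j t) = \sum_(j <- s) b (f j).
Proof.
move=> lb hf; elim: s => [|j s IH].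
  by rewrite big_nil; under eq_fun do rewrite big_nil; exact: cap_lin0.
under eq_fun do rewrite big_cons.
by rewrite big_cons (cap_linD lb (hf j) (in_cap_sum s hf)) IH.
Qed.

Section little_grothendieck.
Context (I : finType) (b : I -> (T -> R) -> R).
Context (Lam : {ffun I -> bool} -> R) (L : R).
Hypothesis b_lin : forall i, cap_linear (b i).
Hypothesis b_sgn : forall e a g, cap_ball a g ->
  \sum_i sgn R e i * b i g <= Lam e * a.
Hypothesis Lam_mean : mean Lam <= L.

(** Distinct signs are uncorrelated, so only the diagonal terms survive. *)
Lemma mean_decouple (f : I -> T -> R) : (forall i, in_cap (f i)) ->
  \sum_i b i (f i) =
  mean (fun e => \sum_i sgn R e i * b i (fun t => \sum_j f j t * sgn R e j)).
Proof.
move=> hf.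
under [RHS]eq_mean => e.
  under eq_bigr => i _.
    rewrite (cap_lin_sum _ (b_lin i)); last first.
      move=> j; have -> : (fun t => f j t * sgn R e j) =
          (fun t => sgn R e j * f j t) by apply/funext => t; rewrite mulrC.
      exact: in_capZ.
    rewrite mulr_sumr.
    under eq_bigr => j _.
      have -> : (fun t => f j t * sgn R e j) = (fun t => sgn R e j * f j t).
        by apply/funext => t; rewrite mulrC.
      rewrite (cap_linZ (b_lin i) _ (hf j)) mulrA mulrC.
      over.
    over.
  over.
rewrite mean_sum; apply: eq_bigr => i _; rewrite mean_sum (bigD1 i)//= big1.
  by rewrite meanZ mean_sgnM eqxx mulr1 addr0.
by move=> j ji; rewrite meanZ mean_sgnM eq_sym (negbTE ji) mulr0.
Qed.

Lemma cap_lin_mean i (f : {ffun I -> bool} -> T -> R) :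
  (forall e, in_cap (f e)) ->
  b i (fun t => mean (f^~ t)) = mean (fun e => b i (f e)).
Proof.
move=> hf; rewrite /mean.
have -> : (fun t => (\sum_e f e t) / 2 ^+ #|I|) =
    (fun t => (2 ^+ #|I|)^-1 * \sum_e f e t).
  by apply/funext => t; rewrite mulrC.
rewrite (cap_linZ (b_lin i) _ (in_cap_sum _ hf)).
by rewrite (cap_lin_sum _ (b_lin i))// mulrC.
Qed.

Context (D : set T) (A : R).
Hypotheses (mD : measurable D) (DA : (mu D <= A%:E)%E) (A1 : 1 <= A).

Definition square_bound K := forall (f : I -> T -> R) s, 0 < s ->
  (forall i, measurable_fun setT (f i)) ->
  (forall i t, ~ D t -> f i t = 0) ->
  (forall t, \sum_i f i t ^+ 2 <= s ^+ 2) ->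
  \sum_i b i (f i) <= K * s.

Let sqr_le (f : I -> R) s i : 0 < s -> \sum_i f i ^+ 2 <= s ^+ 2 -> `|f i| <= s.
Proof.
move=> s0; rewrite (bigD1 i)//= => h.
have {h} : f i ^+ 2 <= s ^+ 2.
  apply: le_trans h; rewrite lerDl.
  by apply: sumr_ge0 => j _; exact: sqr_ge0.
by rewrite -real_normK ?num_real// ler_pXn2r ?nnegrE// ltW.
Qed.


Lemma cap_lin_bound i g a : 0 <= a -> cap_ball a g -> b i g <= L * a.
Proof.
move=> a0 ga; have hg : in_cap g by exists a.
pose f j := fun t => (j == i)%:R * g t.
have hf j : in_cap (f j) by exact: in_capZ.
have -> : b i g = \sum_j b j (f j).
  rewrite (bigD1 i)//= big1.
    rewrite addr0; congr (b i _); apply/funext => t.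
    by rewrite /f eqxx mul1r.
  by move=> j /negbTE ji; rewrite (cap_linZ (b_lin j) _ hg) ji mul0r.
rewrite mean_decouple//; apply: (@le_trans _ _ (mean (fun e => a * Lam e))).
  apply: le_mean => e; rewrite [leRHS]mulrC; apply: b_sgn.
  apply: (cap_ball_le ga) => [|t].
    apply: in_cap_measurable; apply: in_cap_sum => j.
    have -> : (fun t => f j t * sgn R e j) = (fun t => sgn R e j * f j t).
      by apply/funext => t; rewrite mulrC.
    exact: in_capZ.
  rewrite (bigD1 i)//= big1 ?addr0; last first.
    by move=> j /negbTE ji; rewrite /f ji !mul0r.
  by rewrite normrM normr_sgn mulr1 /f eqxx mul1r.
by rewrite meanZ mulrC ler_wpM2r.
Qed.

Let Lam_ge0 : 0 <= L.
Proof.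
apply: le_trans Lam_mean; apply: mean_ge0 => e.
have h0 : cap_ball 1 (fun=> 0).
  split=> // [t|]; first by rewrite normr0.
  rewrite Ip.unlock; under eq_integral do rewrite normr0 powR0 ?gt_eqF//.
  by rewrite integral0 lee_fin powR_ge0.
have := b_sgn e h0; rewrite mulr1; apply: le_trans.
by rewrite big1// => i _; rewrite cap_lin0// mulr0.
Qed.

Let A0 : 0 <= A. Proof. exact: le_trans A1. Qed.

(** A first finite bound, however large, from which to start improving. *)
Lemma square_bound_trivial : exists2 K, 0 <= K & square_bound K.
Proof.
exists (#|I|%:R * (L * A)); first by rewrite !mulr_ge0.
move=> f s s0 mf fD fs.
have -> : #|I|%:R * (L * A) * s = \sum_(i : I) L * (A * s).
  by rewrite sumr_const -[_ *+ #|_|]mulr_natl !mulrA.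
apply: ler_sum => i _; apply: cap_lin_bound; first by rewrite mulr_ge0// ltW.
apply: (cap_ball_supp mD DA A1 (ltW s0)) => // [t|]; last exact: fD.
exact: (@sqr_le (f^~ t)).
Qed.

(** Cut the random sum of the [f i] at height [4 s]. The bounded part is
    controlled by the mean of [Lam]. What is cut off has, by the fourth moment
    inequality, a mean square at most [(s / 2) ^ 2]; by Bessel's inequality its
    coefficients along the signs form a family like the [f i], but with [s]
    halved, to which the previous bound applies. *)
Lemma square_bound_improve K : square_bound K -> square_bound (4 * A * L + K / 2).
Proof.
move=> HK f s s0 mf fD fs.
have fsup i t : `|f i t| <= s by exact: (@sqr_le (f^~ t)).
have hf i : in_cap (f i).
  by exists (A * s); apply: (cap_ball_supp mD DA A1 (ltW s0)) => //; exact: fD.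
pose M := 4 * s; have M0 : 0 < M by rewrite mulr_gt0.
pose F e t := \sum_j f j t * sgn R e j.
have mF e : measurable_fun setT (F e).
  rewrite /F; apply: measurable_sum => j; exact: measurable_funM.
have FD e t : ~ D t -> F e t = 0.
  by move=> nD; rewrite /F big1// => j _; rewrite fD// mul0r.
pose c e t := Num.max (- M) (Num.min M (F e t)).
have mc e : measurable_fun setT (c e).
  by apply: measurable_maxr => //; exact: measurable_minr.
have cM e t : `|c e t| <= M.
  by rewrite /c ler_norml le_max lexx/= ge_max ge_min lexx/= andbT; lra.
have cD e t : ~ D t -> c e t = 0.
  move=> nD; rewrite /c FD//.
  by rewrite (min_idPr _) ?(ltW M0)// (max_idPr _)// oppr_le0 ltW.
have cb e : cap_ball (A * M) (c e).
  by apply: (cap_ball_supp mD DA A1 (ltW M0)) => //; exact: cD.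
have hc e : in_cap (c e) by exists (A * M).
have hF e : in_cap (F e).
  apply: in_cap_sum => j.
  have -> : (fun t => f j t * sgn R e j) = (fun t => sgn R e j * f j t).
    by apply/funext => t; rewrite mulrC.
  exact: in_capZ.
pose r e t := F e t - c e t.
have hr e : in_cap (r e).
  exact: in_capB.
have r2 e t : r e t ^+ 2 <= (M ^+ 2)^-1 * F e t ^+ 4.
  rewrite ler_pdivlMl ?exprn_gt0// /r /c.
  have [h1|h1] := leP M (F e t).
    rewrite (max_idPr _); last by lra.
    have h2 : 0 <= F e t - M <= F e t by lra.
    have h3 : (F e t - M) ^+ 2 <= F e t ^+ 2 by rewrite ler_pXn2r ?nnegrE//; lra.
    have h4 : M ^+ 2 <= F e t ^+ 2 by rewrite ler_pXn2r ?nnegrE//; lra.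
    by have -> : F e t ^+ 4 = F e t ^+ 2 * F e t ^+ 2; [ring|]; rewrite ler_pM ?sqr_ge0.
  have [h2|h2] := leP (F e t) (- M).
    have h3 : (F e t - - M) ^+ 2 <= F e t ^+ 2.
      by rewrite -[leRHS]sqrrN -[leLHS]sqrrN ler_pXn2r ?nnegrE//; lra.
    have h4 : M ^+ 2 <= F e t ^+ 2.
      by rewrite -[leRHS]sqrrN ler_pXn2r ?nnegrE//; lra.
    by have -> : F e t ^+ 4 = F e t ^+ 2 * F e t ^+ 2; [ring|]; rewrite ler_pM ?sqr_ge0.
  by rewrite subrr expr0n mulr0 exprn_even_ge0.
pose h i t := mean (fun e => sgn R e i * r e t).
have -> : \sum_i b i (f i) =
    mean (fun e => \sum_i sgn R e i * b i (c e)) + \sum_i b i (h i).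
  rewrite mean_decouple//.
  have -> : \sum_i b i (h i) = mean (fun e => \sum_i sgn R e i * b i (r e)).
    rewrite mean_sum; apply: eq_bigr => i _.
    rewrite (@cap_lin_mean i (fun e t => sgn R e i * r e t)); last first.
      by move=> e; exact: in_capZ.
    by apply: eq_mean => e; rewrite (cap_linZ (b_lin i) _ (hr e)).
  rewrite -meanD; apply: eq_mean => e; rewrite -big_split/=.
  apply: eq_bigr => i _; rewrite -mulrDr -(cap_linD (b_lin i) (hc e) (hr e)).
  congr (_ * b i _); apply/funext => t.
  by rewrite /r addrC subrK.
have -> : (4 * A * L + K / 2) * s = L * (A * M) + K * (s / 2).
  by rewrite /M; field.
apply: lerD.
  apply: (@le_trans _ _ (mean (fun e => A * M * Lam e))).
    by apply: le_mean => e; rewrite mulrC; exact: b_sgn.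
  by rewrite meanZ mulrC ler_wpM2r// mulr_ge0// ltW.
apply: HK.
- by rewrite divr_gt0.
- move=> i; rewrite /h /mean; apply: measurable_funM => //.
  apply: measurable_sum => e; apply: measurable_funM => //.
  exact: in_cap_measurable.
- move=> i t nD; rewrite /h -[RHS](mean_cst I 0); apply: eq_mean => e.
  by rewrite /r FD// cD// subrr mulr0.
- move=> t; apply: (le_trans (bessel_sgn _)).
  apply: (@le_trans _ _ (mean (fun e => (M ^+ 2)^-1 * F e t ^+ 4))).
    exact: le_mean.
  rewrite meanZ ler_pdivrMl ?exprn_gt0//.
  apply: le_trans (mean_sgn_sum_pow4 _) _.
  apply: (@le_trans _ _ (3 * (s ^+ 2) ^+ 2)).
    rewrite ler_pM2l// ler_pXn2r ?nnegrE ?sqr_ge0//.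
    by apply: sumr_ge0 => i _; exact: sqr_ge0.
  have -> : M ^+ 2 * (s / 2) ^+ 2 = 4 * (s ^+ 2) ^+ 2 by rewrite /M; field.
  by rewrite ler_wpM2r ?sqr_ge0// ler_nat.
Qed.

(** This is the little Grothendieck inequality, which says that operators from
    [L_infty] to a Hilbert space are 2-summing: the square function of the [f i]
    may be bounded pointwise, while the [b i] are only bounded on average over
    their random signed sums. The improvement above is a contraction whose fixed
    point is [8 * A * L]. *)
Lemma little_grothendieck : square_bound (8 * A * L).
Proof.
have [K0 K00 HK0] := square_bound_trivial.
have HK n : square_bound (8 * A * L + K0 / 2 ^+ n).
  elim: n => [|n IH].
    move=> f s s0 mf fD fs; rewrite expr0 divr1.
    rewrite (le_trans (HK0 f s s0 mf fD fs))// ler_wpM2r ?(ltW s0)//.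
    by rewrite lerDr !mulr_ge0.
  have -> : 8 * A * L + K0 / 2 ^+ n.+1 =
      4 * A * L + (8 * A * L + K0 / 2 ^+ n) / 2.
    by rewrite exprS; field; rewrite expf_neq0.
  exact: square_bound_improve.
move=> f s s0 mf fD fs; apply/ler_addgt0Pr => e e0.
have [n _ /(_ n (leqnn n)) ne] :=
  near_infty_natSinv_lt (PosNum (divr_gt0 e0 (mulr_gt0 (ltr_pwDl ltr01 K00) s0))).
apply: (le_trans (HK n f s s0 mf fD fs)); rewrite mulrDl lerD2l.
move: ne; rewrite /= => ne.
have K1 : 0 < (1 + K0) * s by rewrite mulr_gt0// ltr_pwDl.
move: ne; rewrite ltr_pdivlMr// => /ltW; apply: le_trans.
rewrite mulrAC mulrC ler_pM ?invr_ge0 ?exprn_ge0 ?mulr_ge0 ?(ltW s0)//.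
  rewrite lef_pV2 ?posrE ?exprn_gt0//.
  by rewrite -natrX ler_nat ltn_expl.
by rewrite ler_pM2r// lerDr.
Qed.

End little_grothendieck.
End cap_functions.


(** * Humps *)

Section humps.
Local Open Scope classical_set_scope.
Context d (T : measurableType d) (R : realType).
Context (mu : {measure set T -> \bar R}) (p : R) (p1 : 1 <= p).
Local Notation Ip := (Ip mu p).

Let p0 : 0 < p. Proof. exact: lt_le_trans ltr01 p1. Qed.

Lemma Ip_indic D (g : T -> R) : measurable D ->
  Ip (fun t => \1_D t * g t) = (\int[mu]_(t in D) (`|g t| `^ p)%:E)%E.
Proof.
move=> mD; rewrite Ip.unlock [RHS]integral_mkcond; apply: eq_integral => t _.
rewrite patchE indicE; case: (t \in D); first by rewrite mul1r.
by rewrite mul0r normr0 powR0 ?gt_eqF.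
Qed.

Lemma measurable_superlevel (g : T -> R) (e : R) : measurable_fun setT g ->
  measurable [set t | e < `|g t|].
Proof.
move=> mg; have mh : measurable_fun setT (fun t => `|g t|).
  exact: measurableT_comp.
have -> : [set t | e < `|g t|] = setT `&` (fun t => `|g t|) @^-1` `]e, +oo[.
  by rewrite setTI; apply/seteqP; split=> t /=; rewrite in_itv/= andbT.
by apply: mh => //; exact: measurable_itv.
Qed.

Lemma Ip_chebyshev (g : T -> R) (e : R) : 0 < e -> measurable_fun setT g ->
  ((e `^ p)%:E * mu [set t | (e < `|g t|)%R] <= Ip g)%E.
Proof.
move=> e0 mg; have mD := measurable_superlevel e mg.
rewrite -integral_cst//.
have -> : (\int[mu]_(t in [set t | (e < `|g t|)%R]) cst (e `^ p)%:E t =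
    Ip (fun t => (\1_[set t | (e < `|g t|)%R] t * e)%R))%E.
  rewrite (Ip_indic (fun=> e))//; apply: eq_integral => t _.
  by rewrite gtr0_norm.
apply: le_Ip => // [|t]; first exact: measurable_funM.
rewrite indicE; have [|_] := boolP (t \in _); last by rewrite mul0r normr0.
by rewrite inE/= mul1r (gtr0_norm e0) => /ltW.
Qed.

Context (E : nat -> set T).
Hypotheses (mE : forall m, measurable (E m)) (ndE : nondecreasing_seq E).
Hypotheses (coverE : forall t, exists m, E m t).
Hypotheses (finE : forall m, (mu (E m) < +oo)%E).

(** The integral of an integrable function outside [E m] tends to zero. *)
Lemma Ip_tail (g : T -> R) (c : R) : in_cap mu p g -> 0 < c ->
  exists m0, forall m, (m0 <= m)%N -> (Ip (fun t => \1_(~` E m) t * g t)%R < c%:E)%E.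
Proof.
move=> hg c0; have [mg _ Ig] := (in_capP mu p1 g).1 hg.
pose f t := (`|g t| `^ p)%:E.
have mf : measurable_fun setT f by exact: measurable_powR_norm.
have If : Ip g \is a fin_num by rewrite ge0_fin_numE// Ip_ge0.
have IgE : Ip g = (\int[mu]_t f t)%E by rewrite Ip.unlock.
have cvgE : (\int[mu]_(t in E m) f t)%E @[m --> \oo] --> Ip g.
  rewrite IgE; have <- : \bigcup_m E m = setT.
    by apply/seteqP; split=> // t _; have [m Em] := coverE t; exists m.
  apply: ge0_nondecreasing_set_cvg_integral => // [m|m t _].
    exact: measurable_funTS.
  by rewrite lee_fin powR_ge0.
have split_int m : (Ip g = \int[mu]_(t in E m) f t +
    Ip (fun t => (\1_(~` E m) t * g t)%R))%E.
  rewrite Ip_indic; last exact: measurableC.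
  rewrite IgE -ge0_integral_setU//.
  - by rewrite setUv.
  - exact: measurableC.
  - by rewrite setUv.
  - by move=> t _; rewrite lee_fin powR_ge0.
  - by rewrite disj_set2E setICr.
have intE m : (\int[mu]_(t in E m) f t)%E \is a fin_num.
  rewrite ge0_fin_numE; last by apply: integral_ge0 => t _; rewrite lee_fin powR_ge0.
  apply: le_lt_trans Ig; rewrite (split_int m) leeDl//; exact: Ip_ge0.
have /fine_cvg/cvgr_gt/(_ (fine (Ip g) - c)) :
    (\int[mu]_(t in E m) f t)%E @[m --> \oo] --> (fine (Ip g))%:E.
  by rewrite fineK.
have cI : fine (Ip g) - c < fine (Ip g) by rewrite ltrBlDr ltrDl.
move=> /(_ cI) [m0 _ m0P]; exists m0 => m m0m.
have := m0P m m0m; rewrite /= ltrBlDr -lte_fin EFinD !fineK// (split_int m).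
by rewrite lteD2lE.
Qed.

(* The functionals [b n] are normalized by their value at the functions [x n] of
   the intersection. The indices are cut into consecutive blocks, of size [16 ^ l] for each
   [l]; [s l] bounds the square function of the [x n] in a block, and [L l] the
   mean norm of the random signed sums of the [b n] in a block. *)
Context (x : nat -> T -> R) (b : nat -> (T -> R) -> R) (C : R).
Hypotheses (C0 : 0 < C) (x_ball : forall n, cap_ball mu p C (x n)).
Hypotheses (b_lin : forall n, cap_linear mu p (b n)).
Hypothesis b_bound : forall n a g, cap_ball mu p a g -> `|b n g| <= C * a.
Hypothesis bx : forall n, b n (x n) = 1.

Context (s L : nat -> R) (Lam : forall l, {ffun 'I_(16 ^ l) -> bool} -> R).
Hypotheses (s_gt0 : forall l, 0 < s l).
Hypothesis x_block : forall l q t,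
  \sum_(j < 16 ^ l) x (q * 16 ^ l + j) t ^+ 2 <= s l ^+ 2.
Hypothesis b_block : forall l q e a g, cap_ball mu p a g ->
  \sum_(j < 16 ^ l) sgn R e j * b (q * 16 ^ l + j) g <= Lam e * a.
Hypothesis Lam_mean : forall l, mean (@Lam l) <= L l.
Hypothesis sL_small : forall eta, 0 < eta ->
  exists l0, forall l, (l0 <= l)%N -> s l * L l <= eta * (16 ^ l)%:R.

Let hx n : in_cap mu p (x n). Proof. by exists C. Qed.

Let mx n : measurable_fun setT (x n). Proof. by have [] := x_ball n. Qed.

Lemma block_grothendieck l q D A (f : 'I_(16 ^ l) -> T -> R) :
  measurable D -> (mu D <= A%:E)%E -> 1 <= A ->
  (forall j, measurable_fun setT (f j)) ->
  (forall j t, ~ D t -> f j t = 0) ->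
  (forall j t, `|f j t| <= `|x (q * 16 ^ l + j) t|) ->
  \sum_(j < 16 ^ l) b (q * 16 ^ l + j) (f j) <= 8 * A * (s l * L l).
Proof.
move=> mD DA A1 mf fD fx.
have := @little_grothendieck _ _ _ mu p p1 'I_(16 ^ l)
  (fun j => b (q * 16 ^ l + j)) (@Lam l) (L l) _ _ (Lam_mean l) D A mD DA A1.
rewrite [s l * _]mulrC !mulrA.
apply=> // [e a g ag|t]; first exact: b_block.
apply: le_trans (x_block l q t); apply: ler_sum => j _.
by rewrite -[leLHS]real_normK ?num_real// -[leRHS]real_normK ?num_real//
  ler_pXn2r ?nnegrE.
Qed.

Lemma expr16_unbounded (a : R) : exists k, a < (16 ^ k)%:R.
Proof.
exists (Num.trunc `|a|).+1; apply: (le_lt_trans (ler_norm a)).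
have := truncnS_gt `|a|; move=> /lt_le_trans; apply; rewrite ler_nat.
by apply: ltnW; apply: ltn_expl.
Qed.

Lemma le_sum_threshold (F : nat -> R) (u v : R) (n0 K : nat) :
  (forall q, (q < n0)%N -> - v <= F q) ->
  (forall q, (n0 <= q)%N -> u <= F q) -> 0 <= u + v ->
  K%:R * u - n0%:R * (u + v) <= \sum_(0 <= q < K) F q.
Proof.
move=> Fv Fu uv; have : K%:R * u - (minn K n0)%:R * (u + v) <= \sum_(0 <= q < K) F q.
  elim: K => [|K IH]; first by rewrite big_geq// min0n !mul0r subr0.
  rewrite big_nat_recr//=; have [Kn|nK] := ltnP K n0.
    rewrite (minn_idPl _)//; have := Fv _ Kn.
    move: IH; rewrite (minn_idPl (ltnW Kn)) -natr1; lra.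
  rewrite (minn_idPr (leq_trans nK (leqnSn K))); have := Fu _ nK.
  move: IH; rewrite (minn_idPr nK) -natr1; lra.
by apply: le_trans; rewrite lerD2l lerN2 ler_wpM2r// ler_nat geq_minr.
Qed.

(** Seen through a set of finite measure, the pairing of [b n] with [x n] is
    small on average over a long initial segment of the indices, hence over one
    of the blocks that make up this segment, beyond any given one. *)
Lemma escape l m n0 : exists2 q, (n0 <= q)%N &
  \sum_(j < 16 ^ l) b (q * 16 ^ l + j)
     (fun t => \1_(E m) t * x (q * 16 ^ l + j) t) <= (16 ^ l)%:R / 4.
Proof.
apply: contrapT => Hno.
pose F n := b n (fun t => \1_(E m) t * x n t).
have {Hno} big q : (n0 <= q)%N ->
    (16 ^ l)%:R / 4 <= \sum_(j < 16 ^ l) F (q * 16 ^ l + j)%N.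
  by move=> nq; rewrite leNgt; apply/negP => h; apply: Hno; exists q => //; exact: ltW.
have FC n : - (C * C) <= F n.
  have : `|F n| <= C * C by apply: b_bound; exact: cap_ball_indic.
  by rewrite ler_norml => /andP[].
have fE : mu (E m) \is a fin_num by rewrite ge0_fin_numE.
pose A := Num.max 1 (fine (mu (E m))).
have A1 : 1 <= A by rewrite le_max lexx.
have A0 : 0 < A by exact: lt_le_trans A1.
have EA : (mu (E m) <= A%:E)%E by rewrite -[leLHS]fineK// lee_fin le_max lexx orbT.
have [|l0 l0P] := sL_small (eta := (64 * A)^-1); first by rewrite invr_gt0 mulr_gt0.
pose N : R := (16 ^ l)%:R; have N0 : 0 < N by rewrite ltr0n expn_gt0.
have [k kP] := expr16_unbounded (8 * (n0%:R * (N / 4 + N * (C * C))) / N).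
pose K := (l0 + k)%N; have kK : (16 ^ k)%:R <= (16 ^ K)%:R :> R.
  by rewrite ler_nat leq_exp2l// leq_addl.
have up : \sum_(0 <= q < 16 ^ K) \sum_(j < 16 ^ l) F (q * 16 ^ l + j)%N
    <= (16 ^ K)%:R * N / 8.
  have -> : \sum_(0 <= q < 16 ^ K) \sum_(j < 16 ^ l) F (q * 16 ^ l + j)%N =
     \sum_(j < 16 ^ (K + l)) F (0 * 16 ^ (K + l) + j)%N.
    rewrite -(big_mkord xpredT (fun j => F (0 * _ + j)%N)) expnD big_nat_mul.
    apply: eq_bigr => q _.
    rewrite -[X in \sum_(X <= _ < _) _]add0n big_addn mulSn addnK big_mkord.
    by apply: eq_bigr => j _; rewrite mul0n add0n addnC.
  apply: le_trans (block_grothendieck (D := E m) (A := A) (q := 0)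
     (f := fun (j : 'I_(16 ^ (K + l))) t =>
       \1_(E m) t * x (0 * 16 ^ (K + l) + j) t) _ _ _ _ _ _) _ => //.
  - by move=> j; exact: measurable_funM.
  - by move=> j t nE; rewrite indicE memNset// mul0r.
  - move=> j t; rewrite normrM indicE; case: (t \in _).
      by rewrite normr1 mul1r.
    by rewrite normr0 mul0r.
  have Kl : (l0 <= K + l)%N by rewrite -addnA leq_addr.
  have := l0P _ Kl; rewrite expnD natrM -/N ler_pdivlMl ?mulr_gt0//; lra.
have lo : (16 ^ K)%:R * (N / 4) - n0%:R * (N / 4 + N * (C * C)) <=
    \sum_(0 <= q < 16 ^ K) \sum_(j < 16 ^ l) F (q * 16 ^ l + j)%N.
  apply: le_sum_threshold => [q _|q|]; last 2 first.
  - exact: big.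
  - by rewrite addr_ge0 ?mulr_ge0 ?(ltW N0) ?(ltW C0).
  have -> : - (N * (C * C)) = \sum_(j < 16 ^ l) - (C * C).
    by rewrite sumr_const card_ord -[_ *+ _]mulr_natl mulrN.
  exact: ler_sum.
move: (le_trans lo up) kP kK; rewrite ltr_pdivrMr//; nra.
Qed.


(** In a block that escapes [E m], almost all of the pairing of [b n] with [x n]
    comes from outside [E m]. What lies there with a small [L_p] norm is, up to a
    uniformly small remainder, carried by a set of measure at most one for the
    whole block, so that it contributes little on average. *)
Lemma hump_exists : exists2 c, 0 < c & forall m n0, exists n m',
  [/\ (n0 <= n)%N, (m <= m')%N,
      (c%:E <= Ip (fun t => (\1_(E m' `\` E m) t * x n t)%R))%E &
      1 / 4 <= b n (fun t => \1_(E m' `\` E m) t * x n t)].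
Proof.
have [|l /(_ l (leqnn l)) sL] := sL_small (eta := 64^-1); first by rewrite invr_gt0.
pose N : R := (16 ^ l)%:R; have N0 : 0 < N by rewrite ltr0n expn_gt0.
have N1 : 1 <= N by rewrite ler1n expn_gt0.
pose e := (8 * C)^-1; have e0 : 0 < e by rewrite invr_gt0 mulr_gt0.
have ep0 : 0 < e `^ p by exact: powR_gt0.
have tp0 : 0 < 2 `^ p :> R by exact: powR_gt0.
(* With this value, the set where one of the functions [u j] below exceeds [e]
   has measure at most [N^-1]. *)
pose c := e `^ p / (2 `^ p * 2 * N).
have c0 : 0 < c by rewrite divr_gt0// !mulr_gt0.
exists c => // m n0; have [q n0q Eq] := escape l m n0.
apply: contrapT => Hno.
pose y j := x (q * 16 ^ l + j)%N.
pose B j := b (q * 16 ^ l + j)%N.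
have ylin j : cap_linear mu p (B j) by exact: b_lin.
have hy j : in_cap mu p (y j) by exact: hx.
have [m' mm' tail] : exists2 m', (m <= m')%N & forall j : 'I_(16 ^ l),
    (Ip (fun t => (\1_(~` E m') t * y j t)%R) < c%:E)%E.
  have /choice[M MP] : forall j : 'I_(16 ^ l), exists m0, forall m, (m0 <= m)%N ->
      (Ip (fun t => (\1_(~` E m) t * y j t)%R) < c%:E)%E.
    by move=> j; exact: Ip_tail.
  exists (maxn m (\max_j M j)); first by rewrite leq_maxl.
  by move=> j; apply: MP; rewrite (leq_trans _ (leq_maxr _ _))// (leq_bigmax j).
pose hump j t := \1_(E m' `\` E m) t * y j t.
pose tl j t := \1_(~` E m') t * y j t.
have EmE : E m `<=` E m' by rewrite -subsetEset; exact: ndE.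
have mW : measurable (E m' `\` E m) by exact: measurableD.
have mV : measurable (~` E m') by exact: measurableC.
have hhump j : in_cap mu p (hump j) by exact: in_cap_indic.
have htl j : in_cap mu p (tl j) by exact: in_cap_indic.
have hE j : in_cap mu p (fun t => \1_(E m) t * y j t) by exact: in_cap_indic.
have fail (j : 'I_(16 ^ l)) : (c%:E <= Ip (hump j))%E -> B j (hump j) < 1 / 4.
  move=> ch; rewrite ltNge; apply/negP => Bh; apply: Hno.
  exists (q * 16 ^ l + j)%N, m'; split=> //.
  apply: (leq_trans n0q); apply: (leq_trans _ (leq_addr _ _)).
  by rewrite leq_pmulr// expn_gt0.
pose a j : R := (`[< (c%:E <= Ip (hump j))%E >])%:R.
(* the part of [y j] outside [E m] whose p-th power has a small integral *)
pose u j t := tl j t + (1 - a j) * hump j t.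
have hu j : in_cap mu p (u j) by apply: in_capD => //; exact: in_capZ.
have mu_ j : measurable_fun setT (u j) by exact: in_cap_measurable (hu j).
have y_split j : y j = (fun t => \1_(E m) t * y j t + (a j * hump j t + u j t)).
  apply/funext => t; rewrite /u /tl /hump.
  have -> : \1_(E m) t * y j t + (a j * (\1_(E m' `\` E m) t * y j t) +
    (\1_(~` E m') t * y j t + (1 - a j) * (\1_(E m' `\` E m) t * y j t))) =
    (\1_(E m) t + \1_(E m' `\` E m) t + \1_(~` E m') t) * y j t by ring.
  suff -> : \1_(E m) t + \1_(E m' `\` E m) t + \1_(~` E m') t = 1 :> R.
    by rewrite mul1r.
  rewrite !indicE in_setD in_setC; have [Et|] := boolP (t \in E m).
    have -> : t \in E m' by rewrite inE; apply: EmE; rewrite inE in Et.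
    by rewrite /= !addr0.
  by case: (t \in E m'); rewrite /= ?addr0 ?add0r.
have uy j t : `|u j t| <= `|y j t|.
  rewrite /u /tl /hump /a !indicE in_setD in_setC.
  case: asboolP => _; case: (t \in E m'); case: (t \in E m);
  rewrite /= ?mul0r ?mul1r ?subrr ?subr0 ?mulr0 ?mul0r ?addr0 ?add0r ?mul1r ?normr0//.
have Iu (j : 'I_(16 ^ l)) : (Ip (u j) <= (e `^ p / N)%:E)%E.
  have := Ip_add_le mu p1 (in_cap_measurable (htl j))
    (in_cap_measurable (in_capZ p1 (1 - a j) (hhump j))).
  move=> /le_trans; apply.
  have -> : e `^ p / N = 2 `^ p * (c + c).
    by rewrite /c; field; rewrite !gt_eqF.
  rewrite EFinM lee_wpmul2l ?lee_fin ?(ltW tp0)// EFinD leeD//; first exact: ltW (tail j).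
  rewrite /a; case: asboolP => [_|/negP].
    rewrite subrr; under eq_fun do rewrite mul0r.
    by rewrite Ip.unlock; under eq_integral do rewrite normr0 powR0 ?gt_eqF//;
      rewrite integral0 lee_fin ltW.
  rewrite -ltNge subr0; under eq_fun do rewrite mul1r.
  exact: ltW.
pose D j := [set t | e < `|u j t|].
have mD j : measurable (D j) by exact: measurable_superlevel.
pose DD := \big[setU/set0]_(j < 16 ^ l) D j.
have mDD : measurable DD by apply: bigsetU_measurable.
have DD1 : (mu DD <= 1%:E)%E.
  apply: (le_trans (Boole_inequality mu (A := D) (n := (16 ^ l)%N) _)) => //.
  have -> : (1%:E = \sum_(j < 16 ^ l) (N^-1)%:E :> \bar R)%E.
    rewrite sumEFin sumr_const card_ord -[_ *+ _]mulr_natl -/N mulfV//.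
    by rewrite gt_eqF.
  apply: lee_sum => j _; rewrite -(@lee_pmul2l _ (e `^ p)%:E)//.
  apply: (le_trans (Ip_chebyshev e0 (mu_ j))).
  by rewrite -EFinM Iu.
pose f j t := \1_(D j) t * u j t.
have hf j : in_cap mu p (f j) by exact: in_cap_indic.
have fsum : \sum_(j < 16 ^ l) B j (f j) <= N / 8.
  apply: le_trans (block_grothendieck (f := fun j : 'I_(16 ^ l) => f j)
    mDD DD1 (lexx 1) _ _ _) _.
  - by move=> j; exact: in_cap_measurable (hf j).
  - move=> j t nD; rewrite /f indicE memNset ?mul0r// => Dt; apply: nD.
    by rewrite /DD -bigcup_mkord; exists j => /=.
  - move=> j t; apply: le_trans (uy j t); rewrite /f normrM indicE.
    by case: (t \in _); rewrite ?normr1 ?mul1r// normr0 mul0r.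
  by move: sL; rewrite -/N; lra.
have usmall (j : 'I_(16 ^ l)) : B j (fun t => u j t - f j t) <= 1 / 8.
  have -> : 1 / 8 = C * e by rewrite /e; field; rewrite gt_eqF.
  apply: (le_trans (ler_norm _)); apply: b_bound.
  have mr : measurable_fun setT (fun t => u j t - f j t).
    by apply: measurable_funB => //; exact: in_cap_measurable (hf j).
  split=> // [t|].
    rewrite /f indicE; have [_|] := boolP (t \in D j).
      by rewrite mul1r subrr normr0 ltW.
    by rewrite mul0r subr0 notin_setE /D/= => /negP; rewrite -leNgt.
  apply: (@le_trans _ _ (Ip (u j))).
    apply: le_Ip => // t; rewrite /f indicE.
    by case: (t \in _); rewrite ?mul1r ?subrr ?normr0// mul0r subr0.
  apply: (le_trans (Iu j)); rewrite lee_fin ler_pdivrMr//.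
  by rewrite ler_peMr// ltW.
have ahump (j : 'I_(16 ^ l)) : B j (fun t => a j * hump j t) <= 1 / 4.
  rewrite (cap_linZ (ylin j) _ (hhump j)) /a.
  by case: asboolP => [/fail/ltW|_]; rewrite ?mul1r// mul0r ?invr_ge0.
have : N <= N / 4 + N / 4 + N / 8 + N / 8; last by move: N0; lra.
rewrite [leLHS](_ : _ = \sum_(j < 16 ^ l) B j (y j)); last first.
  by under eq_bigr do rewrite /B /y bx; rewrite sumr_const card_ord.
have sumN (z : R) : \sum_(j < 16 ^ l) z = N * z.
  by rewrite sumr_const card_ord -[_ *+ _]mulr_natl.
under eq_bigr => j _.
  rewrite y_split (cap_linD (ylin j) (hE j)
    (in_capD p1 (in_capZ p1 (a j) (hhump j)) (hu j))).
  rewrite (cap_linD (ylin j) (in_capZ p1 (a j) (hhump j)) (hu j)).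
  have uE : u j = (fun t => (u j t - f j t) + f j t).
    by apply/funext => t; rewrite subrK.
  rewrite [in X in _ + (_ + X)]uE.
  rewrite (cap_linD (ylin j) (in_capB p1 (hu j) (hf j)) (hf j)).
  over.
rewrite !big_split/= !addrA; apply: lerD fsum.
apply: lerD; first apply: lerD => //.
- have -> : N / 4 = \sum_(j < 16 ^ l) 1 / 4 by rewrite sumN mul1r.
  exact: ler_sum.
- have -> : N / 8 = \sum_(j < 16 ^ l) 1 / 8 by rewrite sumN mul1r.
  exact: ler_sum.
Qed.

End humps.


(** * Disjoint humps are incompatible with p <> 2 *)

Section disjoint_humps.
Local Open Scope classical_set_scope.
Context d (T : measurableType d) (R : realType).
Context (mu : {measure set T -> \bar R}) (p : R) (p1 : 1 <= p).
Local Notation Ip := (Ip mu p).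

Let p0 : 0 < p. Proof. exact: lt_le_trans ltr01 p1. Qed.

Lemma powR_unbounded (a r : R) : 0 < r ->
  exists2 K : nat, (0 < K)%N & a < K%:R `^ r.
Proof.
move=> r0; pose z := Num.max 1 a `^ r^-1.
exists (Num.trunc z).+1 => //.
have z0 : 0 <= z by exact: powR_ge0.
have m0 : 0 <= Num.max 1 a by rewrite le_max ler01.
apply: (@le_lt_trans _ _ (z `^ r)).
  rewrite -powRrM mulVf ?gt_eqF// powRr1//; by rewrite le_max lexx orbT.
by rewrite gt0_ltr_powR ?nnegrE// truncnS_gt.
Qed.

Context (E : nat -> set T).
Hypotheses (mE : forall m, measurable (E m)) (ndE : nondecreasing_seq E).
Context (x : nat -> T -> R) (b : nat -> (T -> R) -> R) (c : R).

(** The gliding hump construction: each hump is found beyond the set that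
    contains the previous ones. *)
Lemma hump_sequence :
  (forall m n0, exists n m', [/\ (n0 <= n)%N, (m <= m')%N,
      (c%:E <= Ip (fun t => (\1_(E m' `\` E m) t * x n t)%R))%E &
      1 / 4 <= b n (fun t => \1_(E m' `\` E m) t * x n t)]) ->
  exists (n : nat -> nat) (A : nat -> set T),
    [/\ injective n, forall k, measurable (A k), trivIset setT A,
      forall k, (c%:E <= Ip (fun t => (\1_(A k) t * x (n k) t)%R))%E &
      forall k, 1 / 4 <= b (n k) (fun t => \1_(A k) t * x (n k) t)].
Proof.
move=> H.
have {H} /choice[g Hg] : forall s : nat * nat, exists r : nat * nat,
    [/\ (s.1 <= r.1)%N, (s.2 <= r.2)%N,
      (c%:E <= Ip (fun t => (\1_(E r.2 `\` E s.2) t * x r.1 t)%R))%E &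
      1 / 4 <= b r.1 (fun t => \1_(E r.2 `\` E s.2) t * x r.1 t)].
  by move=> [n0 m]; have [n [m' ?]] := H m n0; exists (n, m').
pose st := fix st k := if k is k'.+1 then ((g (st k')).1.+1, (g (st k')).2)
  else (0%N, 0%N).
pose n k := (g (st k)).1; pose m k := (st k).2.
have n_lt k : (n k < n k.+1)%N by have [] := Hg (st k.+1).
have n_homo : {homo n : i j / (i < j)%N} by apply: homo_ltn => //; exact: ltn_trans.
have m_homo : {homo m : i j / (i <= j)%N}.
  by apply: homo_leq => [//||k]; [exact: leq_trans|have [] := Hg (st k)].
have Edis i j : (i < j)%N ->
    (E (m i.+1) `\` E (m i)) `&` (E (m j.+1) `\` E (m j)) = set0.
  move=> ij; apply/seteqP; split=> // t [[Et _] [_ nEt]]; apply: nEt.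
  have : E (m i.+1) `<=` E (m j) by rewrite -subsetEset; apply/ndE/m_homo.
  exact.
exists n, (fun k => E (m k.+1) `\` E (m k)); split.
- move=> i j nij; apply/eqP; rewrite eqn_leq; apply/andP.
  by split; rewrite leqNgt; apply/negP => /n_homo; rewrite nij ltnn.
- by move=> k; exact: measurableD.
- apply/trivIsetP => i j _ _; rewrite neq_ltn => /orP[|] ij; first exact: Edis.
  by rewrite setIC; exact: Edis.
- by move=> k; have [] := Hg (st k).
- by move=> k; have [] := Hg (st k).
Qed.

Context (n : nat -> nat) (A : nat -> set T).
Hypotheses (mA : forall k, measurable (A k)) (tA : trivIset setT A).

Lemma trivIset_sum_indic (K : nat) (t : T) :
  (exists2 k : 'I_K, forall F : 'I_K -> R, \sum_(j < K) \1_(A j) t * F j = F k &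
     A k t) \/
  (forall (F : 'I_K -> R) (j : 'I_K), \1_(A j) t * F j = 0).
Proof.
have [[k Ak]|nA] := pselect (exists k : 'I_K, A k t); [left|right]; last first.
  move=> F j; rewrite indicE memNset ?mul0r// => Aj; apply: nA; by exists j.
exists k => // F; rewrite (bigD1 k)//= big1 ?addr0 => [|j jk].
  by rewrite indicE mem_set// mul1r.
rewrite indicE memNset ?mul0r// => Aj; move/negP: jk; apply; apply/eqP/val_inj.
by apply: (tA I I); exists t.
Qed.

(** The disjoint humps make the mean [L_p] norm of the random sums of the first
    [K] terms grow at least like [K ^ (1/p)], which exceeds [K ^ (1/2)]. *)
Lemma no_humps_lt2 (B : R) : p < 2 -> 0 < c ->
  (forall k, measurable_fun setT (x k)) ->
  (forall k, (c%:E <= Ip (fun t => (\1_(A k) t * x (n k) t)%R))%E) ->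
  (forall K (e : {ffun 'I_K -> bool}),
    (Ip (fun t => (\sum_(k < K) x (n k) t * sgn R e k)%R) <=
       (B * K%:R `^ (p / 2))%:E)%E) -> False.
Proof.
move=> p2 c0 mx Hc HB.
have [|K K0 KP] := @powR_unbounded (2 * B / c) (1 - p / 2); first by lra.
suff : ((c * K%:R)%:E <= (2 * (B * K%:R `^ (p / 2)))%:E)%E.
  rewrite lee_fin leNgt => /negP; apply.
  have K0' : 0 < K%:R :> R by rewrite ltr0n.
  have -> : c * K%:R = c * (K%:R `^ (1 - p / 2) * K%:R `^ (p / 2)).
    rewrite -powRD; last by rewrite (gt_eqF K0') implybT.
    by rewrite subrK powRr1// ltW.
  rewrite !mulrA ltr_pM2r ?powR_gt0// [ltRHS]mulrC -ltr_pdivrMr//.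
pose F e t := \sum_(k < K) x (n k) t * sgn R e k.
have mF e : measurable_fun setT (F e).
  by apply: measurable_sum => k; exact: measurable_funM.
pose y (k : nat) t := \1_(A k) t * x (n k) t.
have my k : measurable_fun setT (y k) by exact: measurable_funM.
pose w : R := 2 / 2 ^+ #|'I_K|.
have w0 : 0 <= w by rewrite divr_ge0// exprn_ge0.
apply: (@le_trans _ _ (\sum_(k < K) Ip (y k))%E).
  have -> : (c * K%:R)%:E = (\sum_(k < K) c%:E)%E.
    by rewrite sumEFin sumr_const card_ord -[c *+ _]mulr_natr.
  by apply: lee_sum => k _; exact: Hc.
have -> : (\sum_(k < K) Ip (y k) = \int[mu]_t \sum_(k < K) (`|y k t| `^ p)%:E)%E.
  rewrite ge0_integral_sum//; first by rewrite Ip.unlock.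
  by move=> k; exact: measurable_powR_norm.
apply: (@le_trans _ _ (\int[mu]_t \sum_e (w%:E * (`|F e t| `^ p)%:E))%E).
  apply: ge0_le_integral => //.
  - by move=> t _; apply: sume_ge0 => k _; rewrite lee_fin powR_ge0.
  - by apply: emeasurable_sum => k; exact: measurable_powR_norm.
  - apply: emeasurable_sum => e; apply: emeasurable_funM => //.
    exact: measurable_powR_norm.
  move=> t _; under [leRHS]eq_bigr do rewrite -EFinM.
  rewrite !sumEFin lee_fin -mulr_sumr /w.
  have F0 : 0 <= \sum_e `|F e t| `^ p by apply: sumr_ge0 => e _; exact: powR_ge0.
  have yE k : `|y k t| `^ p = \1_(A k) t * `|x (n k) t| `^ p.
    rewrite /y indicE; case: (t \in A k); first by rewrite !mul1r.
    by rewrite !mul0r normr0 powR0 ?gt_eqF.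
  under eq_bigr do rewrite yE.
  have [[k -> _]|E0] := trivIset_sum_indic K t; last first.
    rewrite big1 => [|k _]; last exact: E0 (fun k : 'I_K => `|x (n k) t| `^ p) k.
    by rewrite mulr_ge0.
  have := @mean_ge_term R 'I_K (fun z => z `^ p) (fun k => x (n k) t) k.
  rewrite /mean mulrA mulrAC; apply=> [z|]; first exact: powR_ge0.
  exact/ge0_ler_powR/ltW.
rewrite ge0_integral_sum//; last 2 first.
- by move=> e; apply: emeasurable_funM => //; exact: measurable_powR_norm.
- by move=> e t _; rewrite mule_ge0 ?lee_fin ?powR_ge0.
have -> : (2 * (B * K%:R `^ (p / 2)))%:E =
    (\sum_(e : {ffun 'I_K -> bool}) (w * (B * K%:R `^ (p / 2)))%:E)%E.
  rewrite sumEFin sumr_const card_ffun card_bool -[_ *+ (_ ^ _)]mulr_natr natrX /w.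
  by congr EFin; field; rewrite expf_neq0.
apply: lee_sum => e _; rewrite ge0_integralZl_EFin//.
- by rewrite [leRHS]EFinM lee_wpmul2l ?lee_fin//; have := HB K e; rewrite Ip.unlock.
- exact: measurable_powR_norm.
Qed.

(** The random sums of [K] disjoint humps have norm at most [K ^ (1/p)], those of
    the functionals at most [K ^ (1/2)], but decoupled they pair to a multiple of
    [K]. *)
Lemma no_humps_gt2 (B C : R) : 2 < p -> 0 < C ->
  (forall k, cap_linear mu p (b k)) -> (forall k, cap_ball mu p C (x k)) ->
  (forall k, 1 / 4 <= b (n k) (fun t => \1_(A k) t * x (n k) t)) ->
  (forall K (e : {ffun 'I_K -> bool}) a g, cap_ball mu p a g ->
    \sum_(k < K) sgn R e k * b (n k) g <= B * K%:R `^ (1 / 2) * a) -> False.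
Proof.
move=> p2 C0 b_lin xC Hb HB.
have r0 : 0 < 1 / 2 - 1 / p.
  by rewrite subr_gt0 !mul1r ltf_pV2 ?posrE.
have [K K0 KP] := powR_unbounded (4 * (B * C)) r0.
have K0' : 0 < K%:R :> R by rewrite ltr0n.
suff : K%:R / 4 <= B * K%:R `^ (1 / 2) * (C * K%:R `^ (1 / p)).
  have KE : K%:R = K%:R `^ (1 / 2 - 1 / p) * (K%:R `^ (1 / 2) * K%:R `^ (1 / p)) :> R.
    rewrite -!powRD; try by rewrite (gt_eqF K0') implybT.
    have -> : 1 / 2 - 1 / p + (1 / 2 + 1 / p) = 1 :> R by field; rewrite gt_eqF.
    by rewrite powRr1// ltW.
  have h : 0 < K%:R `^ (1 / 2) * K%:R `^ (1 / p) :> R by rewrite mulr_gt0 ?powR_gt0.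
  rewrite [in X in X <= _]KE; nra.
pose y (k : 'I_K) t := \1_(A k) t * x (n k) t.
have hy k : in_cap mu p (y k) by apply: in_cap_indic => //; exists C.
apply: (@le_trans _ _ (\sum_(k < K) b (n k) (y k))).
  have -> : K%:R / 4 = \sum_(k < K) 1 / 4 :> R.
    by rewrite sumr_const card_ord -[RHS]mulr_natl mul1r.
  by apply: ler_sum => k _; exact: Hb.
rewrite (@mean_decouple _ _ _ mu p p1 'I_K (fun k => b (n k)))//.
rewrite -[leRHS](mean_cst 'I_K); apply: le_mean => e; apply: HB.
pose G t := \sum_(j < K) y j t * sgn R e j.
have GE t : G t = \sum_(j < K) \1_(A j) t * (x (n j) t * sgn R e j).
  by apply: eq_bigr => j _; rewrite /y mulrA.
have mG : measurable_fun setT G.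
  by apply: measurable_sum => k; apply: measurable_funM => //; exact: in_cap_measurable (hy k).
have K1 : 1 <= K%:R `^ (1 / p) :> R.
  by rewrite -[leLHS](powRr0 K%:R) ler_powR ?ler1n// divr_ge0// ltW.
change (cap_ball mu p (C * K%:R `^ (1 / p)) G); split=> // [t|].
  apply: (@le_trans _ _ C); last by rewrite ler_peMr// ltW.
  rewrite GE; have [[k -> _]|E0] := trivIset_sum_indic K t.
    by rewrite normrM normr_sgn mulr1; have [_] := xC (n k).
  by rewrite big1 ?normr0 ?ltW// => j _; exact: (E0 (fun j : 'I_K => x (n j) t * sgn R e j)).
apply: (@le_trans _ _ (\int[mu]_t \sum_(k < K) (`|y k t| `^ p)%:E)%E).
  rewrite Ip.unlock; apply: ge0_le_integral => //.
  - exact: measurable_powR_norm.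
  - apply: emeasurable_sum => k; apply: measurable_powR_norm.
    exact: in_cap_measurable (hy k).
  move=> t _; rewrite sumEFin lee_fin GE.
  have [[k -> Ak]|E0] := trivIset_sum_indic K t.
    rewrite (bigD1 k)//= normrM normr_sgn mulr1 /y indicE mem_set// mul1r lerDl.
    by apply: sumr_ge0 => j _; exact: powR_ge0.
  rewrite big1 => [|j _]; last exact: (E0 (fun j : 'I_K => x (n j) t * sgn R e j)).
  rewrite normr0 powR0 ?gt_eqF//.
  by apply: sumr_ge0 => j _; exact: powR_ge0.
rewrite ge0_integral_sum//; last first.
  by move=> k; apply: measurable_powR_norm; exact: in_cap_measurable (hy k).
have -> : (C * K%:R `^ (1 / p)) `^ p = \sum_(k < K) C `^ p.
  rewrite powRM ?powR_ge0 ?(ltW C0)// -powRrM mul1r mulVf ?gt_eqF//.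
  by rewrite powRr1// sumr_const card_ord mulr_natr.
rewrite -sumEFin; apply: lee_sum => k _.
by have := cap_ball_indic p1 (mA k) (xC (n k)) => -[_ _]; rewrite Ip.unlock.
Qed.

End disjoint_humps.


(** * Functions and their classes in the two spaces *)

Section classes.
Local Open Scope classical_set_scope.
Context d (T : measurableType d) (R : realType).
Context (mu : {measure set T -> \bar R}) (p : R) (p1 : (1 <= p%:E)%E).
Local Notation Ip := (Ip mu p).
Local Notation L0 := {mfun_ mu, T >-> R}.
Local Notation X := (LpCapLoo mu p1).
Local Notation Y := (LpPlusLoo mu p1).

Let p1R : 1 <= p. Proof. by rewrite -lee_fin. Qed.
Let p0 : 0 < p. Proof. exact: lt_le_trans ltr01 p1R. Qed.

Lemma eq_Ip_ae (g h : T -> R) : measurable_fun setT g -> measurable_fun setT h ->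
  (\forall t \ae mu, g t = h t) -> Ip g = Ip h.
Proof.
move=> mg mh gh; rewrite Ip.unlock; apply: ae_eq_integral => //.
- exact: measurable_powR_norm.
- exact: measurable_powR_norm.
- by apply: filterS gh => t -> _.
Qed.

Lemma Ip_LnormE (h : T -> R) : ('N[mu]_p%:E[EFin \o h] `^ p)%E = Ip h.
Proof.
rewrite poweR_Lnorm ?gt_eqF// Ip.unlock; apply: eq_integral => t _.
by rewrite /= ?poweR_EFin.
Qed.

Lemma Lnorm_leP (h : T -> R) (a : R) : 0 <= a ->
  ('N[mu]_p%:E[EFin \o h] <= a%:E)%E <-> (Ip h <= (a `^ p)%:E)%E.
Proof.
move=> a0; rewrite -Ip_LnormE -poweR_EFin.
have nn (z : \bar R) : (0 <= z)%E -> (z \in `[0%E, +oo%E])%R.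
  by move=> z0; rewrite in_itv/= z0 leey.
split=> h1.
  by apply: gt0_ler_poweR; rewrite ?nn ?(ltW p0) ?Lnorm_ge0 ?lee_fin.
have : (('N[mu]_p%:E[EFin \o h] `^ p) `^ p^-1 <= (a%:E `^ p) `^ p^-1)%E.
  by apply: gt0_ler_poweR; rewrite ?nn ?invr_ge0 ?(ltW p0) ?poweR_ge0.
by rewrite -!poweRrM mulfV ?gt_eqF// !poweRe1 ?Lnorm_ge0.
Qed.

Lemma Lnormy_le (h : T -> R) (a : R) : 0 <= a ->
  (\forall t \ae mu, `|h t| <= a) -> ('N[mu]_+oo[EFin \o h] <= a%:E)%E.
Proof.
move=> a0 ha; rewrite unlock; case: ifPn => _; last by rewrite lee_fin.
by apply/ess_supP; apply: filterS ha => t; rewrite /= lee_fin.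
Qed.

Definition L0_of (h : T -> R) (mh : measurable_fun setT h) : L0 :=
  \pi_(L0)%qT (mfun_Sub (mem_set mh)).

Lemma L0_ofE h (mh : measurable_fun setT h) : \forall t \ae mu, L0_of mh t = h t.
Proof. by apply: filterS (pi_aeE mu (mfun_Sub (mem_set mh))) => t ->. Qed.

Lemma L0norm_p_le (x : L0) (a : R) : 0 <= a -> (Ip x <= (a `^ p)%:E)%E ->
  in_Lp p%:E x /\ L0norm p%:E x <= a.
Proof.
move=> a0 /(Lnorm_leP x a0).2 xa.
have xL : in_Lp p%:E x by rewrite /in_Lp /finite_norm (le_lt_trans xa)// ltry.
by split=> //; rewrite -lee_fin -in_LpE.
Qed.

Lemma L0norm_y_le (x : L0) (a : R) : 0 <= a -> (\forall t \ae mu, `|x t| <= a) ->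
  in_Lp +oo x /\ L0norm +oo x <= a.
Proof.
move=> a0 /(Lnormy_le a0) xa.
have xL : in_Lp +oo x by rewrite /in_Lp /finite_norm (le_lt_trans xa)// ltry.
by split=> //; rewrite -lee_fin -in_LpE.
Qed.

Lemma Ip_L0norm (x : L0) : in_Lp p%:E x -> (Ip x <= (L0norm p%:E x `^ p)%:E)%E.
Proof. by move=> xp; apply/Lnorm_leP; rewrite ?L0norm_ge0// in_LpE. Qed.

Lemma ae_L0norm (x : L0) : in_Lp +oo x ->
  \forall t \ae mu, `|x t| <= L0norm +oo x.
Proof.
move=> xy; apply: filterS (ae_le_Lnormy mu (measurable_L0 x)) => t.
by rewrite in_LpE// lee_fin.
Qed.

(** ** The intersection *)

Lemma cap_normP (x : X) :
  (\forall t \ae mu, `|x t| <= `|x|) /\ (Ip x <= (`|x| `^ p)%:E)%E.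
Proof.
have /asboolP[xp xy] := Lcap_valP x; rewrite LpCapLoo_normE; split.
  apply: filterS (ae_L0norm xy) => t /le_trans; apply.
  by rewrite le_max lexx orbT.
apply: (le_trans (Ip_L0norm xp)); rewrite lee_fin.
by rewrite ge0_ler_powR ?nnegrE ?(ltW p0) ?L0norm_ge0 ?le_max ?L0norm_ge0// lexx.
Qed.

(** Defined for every function, so that a functional on the intersection induces
    one on functions; the value is meaningful when the class of [h] lies in the
    intersection. *)
Definition to_cap (h : T -> R) : X :=
  xget 0 [set x : X | \forall t \ae mu, x t = h t].

Lemma to_capE h : in_cap mu p h -> \forall t \ae mu, to_cap h t = h t.
Proof.
move=> hh; suff [x xh] : exists x : X, \forall t \ae mu, x t = h t.
  exact: (xgetI (P := [set x : X | \forall t \ae mu, x t = h t]) 0 xh).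
have [mh [a ha] Ih] := (in_capP mu p1R h).1 hh.
have hE := L0_ofE mh.
have zP : L0_of mh \in Lcap p%:E; last by exists (MkLpCapLoo p1 zP).
have IE : Ip (L0_of mh) = Ip h by apply: eq_Ip_ae => //; exact: measurable_L0.
apply/asboolP; split.
  have IL : Ip (L0_of mh) = ((fine (Ip h) `^ p^-1) `^ p)%:E.
    rewrite -powRrM mulVf ?gt_eqF// powRr1 ?fine_ge0 ?Ip_ge0// IE fineK//.
    by rewrite ge0_fin_numE ?Ip_ge0.
  by case: (@L0norm_p_le (L0_of mh) (fine (Ip h) `^ p^-1)); rewrite ?IL ?powR_ge0.
case: (@L0norm_y_le (L0_of mh) (Num.max 0 a)) => //; first by rewrite le_max lexx.
by apply: filterS hE => t ->; rewrite le_max ha orbT.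
Qed.

Lemma ae_eq_cap (x y : X) : (\forall t \ae mu, x t = y t) -> x = y.
Proof. by move=> /L0P xy; apply: val_inj. Qed.

Lemma capDE (x y : X) : \forall t \ae mu, (x + y) t = x t + y t.
Proof. exact: L0_addE. Qed.

Lemma capZE a (x : X) : \forall t \ae mu, (a *: x) t = a * x t.
Proof. exact: L0_scaleE. Qed.

Lemma to_capD h k : in_cap mu p h -> in_cap mu p k ->
  to_cap (fun t => h t + k t) = to_cap h + to_cap k.
Proof.
move=> hh hk; apply: ae_eq_cap.
have A := to_capE (in_capD p1R hh hk); have B := to_capE hh.
have C := to_capE hk; have D := capDE (to_cap h) (to_cap k).
by near=> t; rewrite (near A t)// (near D t)// (near B t)// (near C t).
Unshelve. all: by end_near. Qed.

Lemma to_capZ a h : in_cap mu p h -> to_cap (fun t => a * h t) = a *: to_cap h.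
Proof.
move=> hh; apply: ae_eq_cap.
have A := to_capE (in_capZ p1R a hh); have B := to_capE hh.
have D := capZE a (to_cap h).
by near=> t; rewrite (near A t)// (near D t)// (near B t).
Unshelve. all: by end_near. Qed.

Lemma to_cap_norm a h : 0 <= a -> cap_ball mu p a h -> `|to_cap h| <= a.
Proof.
move=> a0 [mh ha Ih]; have hE : \forall t \ae mu, to_cap h t = h t.
  by apply: to_capE; exists a.
rewrite LpCapLoo_normE ge_max; apply/andP; split.
  case: (@L0norm_p_le (val (to_cap h)) a) => //.
  by rewrite (@eq_Ip_ae (to_cap h) h)//; exact: measurable_L0.
case: (@L0norm_y_le (val (to_cap h)) a) => //.
by apply: filterS hE => t ->.
Qed.

(** ** The sum *)

Lemma plus_norm_lt (y : Y) a : `|y| < a -> exists u v : T -> R,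
  [/\ measurable_fun setT u, measurable_fun setT v,
     \forall t \ae mu, y t = u t + v t,
     (Ip u <= (a `^ p)%:E)%E & \forall t \ae mu, `|v t| <= a].
Proof.
rewrite LpPlusLoo_normE => ya.
have [_ [u [v [[up vy yE] ->]]] uva] : exists2 s, [set s | exists u v : L0,
    [/\ in_Lp p%:E u, in_Lp +oo v & \val y = u + v] /\
    s = L0norm p%:E u + L0norm +oo v] s & s < a.
  apply: (inf_lt _ ya); have /asboolP[u [v yuv]] := Lsum_valP y.
  by exists (L0norm p%:E u + L0norm +oo v), u, v.
exists u, v; split; [exact: measurable_L0|exact: measurable_L0| | |].
- change (\forall t \ae mu, (\val y : L0) t = u t + v t).
  by rewrite yE; exact: L0_addE.
- apply: (le_trans (Ip_L0norm up)); rewrite lee_fin.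
  rewrite ge0_ler_powR ?nnegrE ?(ltW p0) ?L0norm_ge0//.
  + by rewrite (le_trans _ (ltW uva))// addr_ge0 ?L0norm_ge0.
  + by rewrite (le_trans _ (ltW uva))// lerDl L0norm_ge0.
- apply: filterS (ae_L0norm vy) => t /le_trans; apply.
  by rewrite (le_trans _ (ltW uva))// lerDr L0norm_ge0.
Qed.

Lemma plus_norm_le (y : Y) (h : T -> R) a : 0 <= a -> measurable_fun setT h ->
  (\forall t \ae mu, y t = h t) -> (Ip h <= (a `^ p)%:E)%E -> `|y| <= a.
Proof.
move=> a0 mh yh Ih.
have [yp ya] : in_Lp p%:E (val y) /\ L0norm p%:E (val y) <= a.
  apply: L0norm_p_le => //.
  by rewrite (@eq_Ip_ae (val y) h)//; exact: measurable_L0.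
have y0 : Lsum_dec p%:E (val y) (val y) 0.
  by split=> //; [apply: in_Lp0; exact: leey|rewrite addr0].
have := Lsum_norm_le y0; rewrite (_ : L0norm +oo 0 = 0) ?addr0.
  by move=> /le_trans; apply.
apply/eqP; rewrite eq_le L0norm_ge0 andbT.
have z0 : \forall t \ae mu, `|(0 : L0) t| <= 0.
  by apply: filterS (L0_zeroE mu) => t z; rewrite [X in `|X|]z normr0.
by have [] := L0norm_y_le (lexx 0) z0.
Qed.

Definition to_plus (h : T -> R) : Y :=
  xget 0 [set y : Y | \forall t \ae mu, y t = h t].

Lemma to_plusE h : measurable_fun setT h -> (Ip h < +oo)%E ->
  \forall t \ae mu, to_plus h t = h t.
Proof.
move=> mh Ih; suff [y yh] : exists y : Y, \forall t \ae mu, y t = h t.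
  exact: (xgetI (P := [set y : Y | \forall t \ae mu, y t = h t]) 0 yh).
have hE := L0_ofE mh.
have zP : L0_of mh \in Lsum p%:E; last by exists (MkLpPlusLoo p1 zP).
have IE : Ip (L0_of mh) = Ip h by apply: eq_Ip_ae => //; exact: measurable_L0.
apply/asboolP; exists (L0_of mh), 0; split; [|by apply: in_Lp0; exact: leey|by rewrite addr0].
have IL : Ip (L0_of mh) = ((fine (Ip h) `^ p^-1) `^ p)%:E.
  rewrite -powRrM mulVf ?gt_eqF// powRr1 ?fine_ge0 ?Ip_ge0// IE fineK//.
  by rewrite ge0_fin_numE ?Ip_ge0.
by case: (@L0norm_p_le (L0_of mh) (fine (Ip h) `^ p^-1)); rewrite ?IL ?powR_ge0.
Qed.

Lemma plusDE (x y : Y) : \forall t \ae mu, (x + y) t = x t + y t.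
Proof. exact: L0_addE. Qed.

Lemma plusZE a (x : Y) : \forall t \ae mu, (a *: x) t = a * x t.
Proof. exact: L0_scaleE. Qed.


End classes.


(** * Bounded orthonormal systems on a set of measure one *)

Section orthonormal_system.
Local Open Scope classical_set_scope.
Context d (T : measurableType d) (R : realType).
Context (mu : {measure set T -> \bar R}) (p : R) (p1 : 1 <= p).
Local Notation Ip := (Ip mu p).

Let p0 : 0 < p. Proof. exact: lt_le_trans ltr01 p1. Qed.

Context (J : set T) (mJ : measurable J) (muJ : mu J = 1%:E).
Context (w : nat -> T -> R).
Hypotheses (mw : forall n, measurable_fun setT (w n)).
Hypotheses (wJ : forall n t, ~ J t -> w n t = 0).
Hypotheses (w1 : forall n t, `|w n t| <= 1).
Hypothesis w_orth : forall n m,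
  (\int[mu]_t (w n t * w m t)%:E)%E = ((n == m)%:R)%:E.

Lemma integrable_supp (h : T -> R) (M : R) : measurable_fun setT h ->
  (forall t, ~ J t -> h t = 0) -> (forall t, `|h t| <= M) ->
  mu.-integrable setT (EFin \o h).
Proof.
move=> mh hJ hM; have M0 : T -> 0 <= M by move=> t; rewrite (le_trans _ (hM t)).
apply: (@le_integrable _ _ _ mu setT measurableT _ (EFin \o (fun t => M * \1_J t))).
- exact/measurable_EFinP.
- move=> t _ /=; rewrite lee_fin indicE.
  have [tJ|] := boolP (t \in J).
    by rewrite mulr1 [leRHS]ger0_norm// M0.
  by rewrite notin_setE => /hJ ->; rewrite normr0 mulr0 normr0.
have -> : (EFin \o (fun t => M * \1_J t)) = (fun t => M%:E * (\1_J t)%:E)%E.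
  by apply/funext => t /=; rewrite EFinM.
apply: integrableZl => //; apply/integrableP; split; first exact/measurable_EFinP.
under eq_integral => t _ do rewrite gee0_abs ?lee_fin//.
by rewrite integral_indic// setIT muJ ltry.
Qed.

Context (N : nat) (n : 'I_N -> nat) (n_inj : injective n).
Implicit Types (a : 'I_N -> R) (S : R).

Definition comb a t := \sum_j a j * w (n j) t.

Lemma measurable_comb a : measurable_fun setT (comb a).
Proof. by apply: measurable_sum => j; exact: measurable_funM. Qed.

Lemma comb_supp a t : ~ J t -> comb a t = 0.
Proof. by move=> nJ; rewrite /comb big1// => j _; rewrite wJ// mulr0. Qed.

Lemma comb_le_sum a t : `|comb a t| <= \sum_j `|a j|.
Proof.
apply: (le_trans (ler_norm_sum _ _ _)); apply: ler_sum => j _.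
by rewrite normrM ler_piMr.
Qed.

Lemma integral_comb_sqr a :
  (\int[mu]_t (comb a t ^+ 2)%:E)%E = (\sum_j a j ^+ 2)%:E.
Proof.
have ww i j : mu.-integrable setT (fun t => (w i t * w j t)%:E).
  apply: (integrable_supp (M := 1)) => [|t nJ|t]; first exact: measurable_funM.
    by rewrite wJ// mul0r.
  by rewrite normrM mulr_ile1.
have E t : (comb a t ^+ 2)%:E =
    (\sum_i \sum_j ((a i * a j)%:E * (w (n i) t * w (n j) t)%:E))%E.
  rewrite expr2 /comb mulr_suml -sumEFin; apply: eq_bigr => i _.
  rewrite mulr_sumr -sumEFin; apply: eq_bigr => j _.
  by rewrite -EFinM mulrACA.
under eq_integral do rewrite E.
rewrite (integral_sum measurableT); last first.
  by move=> i; apply: integrable_sum => // j _; exact: (integrableZl measurableT _ (ww _ _)).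
rewrite -sumEFin; apply: eq_bigr => i _.
rewrite (integral_sum measurableT); last first.
  by move=> j; exact: (integrableZl measurableT _ (ww _ _)).
rewrite (bigD1 i)//= big1 ?adde0; last first.
  move=> j ji; rewrite (integralZl measurableT (ww (n i) (n j))).
  by rewrite w_orth (inj_eq n_inj) eq_sym (negbTE ji) mule0.
by rewrite (integralZl measurableT (ww (n i) (n i))) w_orth eqxx mule1 expr2.
Qed.

(** Cauchy-Schwarz, from the inequality between arithmetic and geometric means
    weighted so that equal coefficients give equality. *)
Lemma sum_norm_le a S : 0 < S -> \sum_j a j ^+ 2 <= S ^+ 2 ->
  \sum_j `|a j| <= Num.sqrt N%:R * S.
Proof.
move=> S0 aS; have [N0|N0] := posnP N.
  by rewrite big1 ?mulr_ge0 ?sqrtr_ge0 ?(ltW S0)// => j; have := ltn_ord j; rewrite {2}N0.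
set q : R := Num.sqrt N%:R.
have q0 : 0 < q by rewrite sqrtr_gt0 ltr0n.
have q2 : q ^+ 2 = N%:R by rewrite sqr_sqrtr.
apply: (@le_trans _ _ (\sum_j (q / (2 * S) * a j ^+ 2 + S / (2 * q)))).
  apply: ler_sum => j _; have := sqr_ge0 (q * `|a j| - S).
  have : a j ^+ 2 = `|a j| ^+ 2 by rewrite real_normK ?num_real.
  move: (`|a j|) => z -> h.
  have -> : q / (2 * S) * z ^+ 2 + S / (2 * q) = (q ^+ 2 * z ^+ 2 + S ^+ 2) / (2 * S * q).
    by field; rewrite !gt_eqF.
  by rewrite ler_pdivlMr ?mulr_gt0//; nra.
rewrite big_split/= -mulr_sumr sumr_const card_ord -[S / _ *+ _]mulr_natl -q2.
apply: (@le_trans _ _ (q / (2 * S) * S ^+ 2 + q ^+ 2 * (S / (2 * q)))).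
  by rewrite lerD2r ler_wpM2l// divr_ge0 ?mulr_ge0 ?ltW.
have -> : q / (2 * S) * S ^+ 2 + q ^+ 2 * (S / (2 * q)) = q * S.
  by field; rewrite !gt_eqF.
by [].
Qed.

(** The norm of the inclusion of the span of [N] terms, with its [L_2] norm,
    into [L_p] is at most this constant. *)
Definition euclid_Lp_cst : R := if p <= 2 then 2 else N%:R `^ (1 / 2 - 1 / p).

Lemma euclid_Lp_cst_gt0 : (0 < N)%N -> 0 < euclid_Lp_cst.
Proof. by rewrite /euclid_Lp_cst; case: ifP => // _ N0; rewrite powR_gt0// ltr0n. Qed.

(** For [p <= 2] this is the comparison of the [L_p] and [L_2] norms on a
    probability space; for [p > 2] it interpolates between the [L_2] norm and
    the trivial bound of the supremum norm. *)
Lemma Ip_comb a S : 0 < S -> \sum_j a j ^+ 2 <= S ^+ 2 ->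
  (Ip (comb a) <= ((euclid_Lp_cst * S) `^ p)%:E)%E.
Proof.
move=> S0 aS; have mF := measurable_comb a.
have mF2 : measurable_fun setT (fun t => (comb a t ^+ 2)%:E).
  by apply/measurable_EFinP; exact: measurable_funX.
have I2 : (\int[mu]_t (comb a t ^+ 2)%:E <= (S ^+ 2)%:E)%E.
  by rewrite integral_comb_sqr lee_fin.
rewrite /euclid_Lp_cst; case: (leP p 2) => p2.
  apply: (@le_trans _ _ (\int[mu]_t ((S `^ p)%:E * (\1_J t)%:E
      + (S `^ p / S ^+ 2)%:E * (comb a t ^+ 2)%:E))%E).
    rewrite Ip.unlock; apply: ge0_le_integral => //.
    - exact: measurable_powR_norm.
    - apply: emeasurable_funD; apply: emeasurable_funM => //.
      exact/measurable_EFinP.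
    move=> t _; rewrite -!EFinM -EFinD lee_fin.
    have [tJ|] := boolP (t \in J); last first.
      rewrite notin_setE => nJ; rewrite (comb_supp a nJ) normr0 powR0 ?gt_eqF//.
      by rewrite expr0n mulr0 addr0 mulr_ge0// powR_ge0.
    rewrite indicE tJ mulr1 -[comb a t ^+ 2]real_normK ?num_real//.
    have : 0 <= `|comb a t| by [].
    move: (`|comb a t|) => z z0.
    have -> : z = S * (z / S) by field; rewrite gt_eqF.
    have {z0}: 0 <= z / S by rewrite divr_ge0// ltW.
    move: (z / S) => u u0; rewrite powRM ?(ltW S0)//.
    have -> : S `^ p + S `^ p / S ^+ 2 * (S * u) ^+ 2 = S `^ p * (1 + u ^+ 2).
      by field; rewrite gt_eqF.
    rewrite ler_pM2l ?powR_gt0//; have [u1|u1] := leP u 1.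
      apply: ler_wpDr; first exact: sqr_ge0.
      apply: (@le_trans _ _ (1 `^ p)); last by rewrite powR1.
      by rewrite ge0_ler_powR ?nnegrE// ltW.
    by apply: ler_wpDl => //; rewrite -powR_mulrn// ler_powR// ltW.
  rewrite ge0_integralD//; last 4 first.
  - by move=> t _; rewrite -EFinM lee_fin mulr_ge0 ?powR_ge0.
  - by apply: emeasurable_funM => //; exact/measurable_EFinP.
  - by move=> t _; rewrite -EFinM lee_fin mulr_ge0 ?divr_ge0 ?powR_ge0 ?sqr_ge0.
  - exact: emeasurable_funM.
  rewrite !ge0_integralZl_EFin ?divr_ge0 ?powR_ge0 ?sqr_ge0//; last 2 first.
  - by move=> t _; rewrite lee_fin sqr_ge0.
  - exact/measurable_EFinP.
  rewrite integral_indic// setIT muJ mule1.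
  apply: (@le_trans _ _ ((S `^ p)%:E + (S `^ p / S ^+ 2)%:E * (S ^+ 2)%:E)%E).
    by rewrite leeD2l// lee_wpmul2l// lee_fin divr_ge0 ?powR_ge0 ?sqr_ge0.
  rewrite -EFinM -EFinD lee_fin powRM ?(ltW S0)//.
  have -> : S `^ p + S `^ p / S ^+ 2 * S ^+ 2 = 2 * S `^ p.
    by field; rewrite gt_eqF.
  by rewrite ler_pM2r ?powR_gt0// -[leLHS](powRr1 (ler0n R 2)) ler_powR// ler1n.
have S0' := ltW S0.
have [N0|N0] := posnP N.
  have F0 t : comb a t = 0.
    by rewrite /comb big1// => j; have := ltn_ord j; rewrite {2}N0.
  rewrite Ip.unlock; under eq_integral do rewrite F0 normr0 powR0 ?gt_eqF//.
  by rewrite integral0 lee_fin powR_ge0.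
pose z := Num.sqrt N%:R * S.
have z0 : 0 < z by rewrite mulr_gt0// sqrtr_gt0 ltr0n.
apply: (@le_trans _ _ (\int[mu]_t ((z `^ (p - 2))%:E * (comb a t ^+ 2)%:E))%E).
  rewrite Ip.unlock; apply: ge0_le_integral => //.
  - exact: measurable_powR_norm.
  - exact: emeasurable_funM.
  move=> t _; rewrite -EFinM lee_fin -[comb a t ^+ 2]real_normK ?num_real//.
  have Fz : `|comb a t| <= z := le_trans (comb_le_sum a t) (sum_norm_le S0 aS).
  have [->|F0] := eqVneq `|comb a t| 0.
    by rewrite powR0 ?gt_eqF// mulr_ge0 ?powR_ge0.
  rewrite -powR_mulrn//.
  have {1}-> : p = (p - 2) + 2%:R by rewrite subrK.
  rewrite powRD; last by rewrite F0 implybT.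
  rewrite ler_wpM2r ?powR_ge0// ge0_ler_powR ?nnegrE ?subr_ge0 ?(ltW p2)//.
  exact: ltW.
rewrite ge0_integralZl_EFin ?powR_ge0//; last by move=> t _; rewrite lee_fin sqr_ge0.
apply: (@le_trans _ _ ((z `^ (p - 2))%:E * (S ^+ 2)%:E)%E).
  by rewrite lee_wpmul2l// lee_fin powR_ge0.
rewrite -EFinM lee_fin -[S ^+ 2]powR_mulrn// /z.
rewrite !powRM ?sqrtr_ge0 ?powR_ge0// -mulrA -powRD; last first.
  by rewrite (gt_eqF S0) implybT.
rewrite subrK ler_pM2r ?powR_gt0//.
rewrite -powR12_sqrt// -!powRrM.
have -> : 2^-1 * (p - 2) = (1 / 2 - 1 / p) * p by field; rewrite gt_eqF.
by [].
Qed.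

End orthonormal_system.


(** * Pairing the sum space with bounded functions *)

Section pairing.
Local Open Scope classical_set_scope.
Context d (T : measurableType d) (R : realType).
Context (mu : {measure set T -> \bar R}) (p : R) (p1 : (1 <= p%:E)%E).
Local Notation Ip := (Ip mu p).
Local Notation Y := (LpPlusLoo mu p1).

Let p1R : 1 <= p. Proof. by rewrite -lee_fin. Qed.
Let p0 : 0 < p. Proof. exact: lt_le_trans ltr01 p1R. Qed.

Context (J : set T) (mJ : measurable J) (muJ : mu J = 1%:E).
Implicit Types (F : T -> R) (y : Y) (a k M Q S : R).

(* Functions supported in [J]: the pairing only sees the restriction to [J]. *)
Definition test F := [/\ measurable_fun setT F, exists M, forall t, `|F t| <= M &
  forall t, ~ J t -> F t = 0].

Definition pair F y : R := \int[mu]_t (F t * y t).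

Let measurable_Y y : measurable_fun setT y.
Proof. exact: measurable_L0. Qed.

Lemma measurable_pair F y : measurable_fun setT F ->
  measurable_fun setT (fun t => (F t * y t)%:E).
Proof. by move=> mF; apply/measurable_EFinP; apply: measurable_funM. Qed.

Let indic0 t : 0 <= \1_J t :> R. Proof. by rewrite indicE ler0n. Qed.

(** A pointwise bound valid for every decomposition of the values of [y] into a
    part in [L_p] and a part bounded by [a] can be integrated, because the norm
    of [y] provides such a decomposition. *)
Lemma pair_abs_le F y a k1 k2 k3 Q : 0 < a -> `|y| < a -> test F ->
  0 <= k1 -> 0 <= k2 -> 0 <= k3 ->
  (forall t (u v : R), J t -> `|v| <= a ->
     `|F t * (u + v)| <= k1 + k2 * `|u| `^ p + k3 * F t ^+ 2) ->
  (\int[mu]_t (F t ^+ 2)%:E <= Q%:E)%E ->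
  (\int[mu]_t `|(F t * y t)%:E| <= (k1 + k2 * a `^ p + k3 * Q)%:E)%E.
Proof.
move=> a0 ya [mF _ FJ] k10 k20 k30 H FQ.
have [u [v [mu_ mv yE Iu va]]] := plus_norm_lt ya.
have pos (x1 x2 x3 : R) : 0 <= x1 -> 0 <= x2 -> 0 <= x3 ->
  0 <= k1 * x1 + k2 * x2 + k3 * x3 by move=> *; rewrite !addr_ge0 ?mulr_ge0.
have mu2 := measurable_powR_norm p mu_.
have mF2 : measurable_fun setT (fun t => (F t ^+ 2)%:E).
  by apply/measurable_EFinP; exact: measurable_funX.
have mJ1 : measurable_fun setT (fun t => (\1_J t : R)%:E) by exact/measurable_EFinP.
apply: (@le_trans _ _ (\int[mu]_t ((k1%:E * (\1_J t)%:E + k2%:E * (`|u t| `^ p)%:E)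
  + k3%:E * (F t ^+ 2)%:E))%E).
  apply: ae_ge0_le_integral => //.
  - by apply: measurableT_comp => //; exact: measurable_pair.
  - move=> t _; rewrite -!EFinM -!EFinD lee_fin.
    by rewrite pos ?indic0 ?powR_ge0 ?sqr_ge0.
  - by apply: emeasurable_funD; [apply: emeasurable_funD|]; exact: measurable_funeM.
  apply: filterS2 yE va => t yE va _; rewrite -!EFinM -!EFinD lee_fin /=.
  have [tJ|] := boolP (t \in J).
    by rewrite indicE tJ mulr1 [X in F t * X]yE; apply: H => //; rewrite inE in tJ.
  rewrite notin_setE => /FJ ->; rewrite mul0r normr0.
  by rewrite pos ?indic0 ?powR_ge0 ?sqr_ge0.
have z1 t : (0 <= k1%:E * (\1_J t)%:E)%E by rewrite -EFinM lee_fin mulr_ge0 ?indic0.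
have z2 t : (0 <= k2%:E * (`|u t| `^ p)%:E)%E.
  by rewrite -EFinM lee_fin mulr_ge0 ?powR_ge0.
have z3 t : (0 <= k3%:E * (F t ^+ 2)%:E)%E.
  by rewrite -EFinM lee_fin (mulr_ge0 k30 (sqr_ge0 _)).
rewrite ge0_integralD//; last 3 first.
- by move=> t _; rewrite adde_ge0.
- by apply: emeasurable_funD; exact: measurable_funeM.
- exact: measurable_funeM.
rewrite ge0_integralD//; last 2 first.
- exact: measurable_funeM.
- exact: measurable_funeM.
rewrite !ge0_integralZl_EFin//; last first.
  by move=> t _; rewrite lee_fin sqr_ge0.
rewrite integral_indic// setIT muJ mule1 !EFinD !EFinM.
rewrite Ip.unlock in Iu.
by rewrite leeD//; [rewrite leeD2l//|]; rewrite lee_wpmul2l.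
Qed.

(** Below [a] the first term suffices, above [a] the second one: this is how
    [L_p] embeds in [L_r] on a set of finite measure. *)
Lemma young_le a u r : 0 < a -> 0 <= u -> 0 <= r -> r <= p ->
  u `^ r <= a `^ r + a `^ (r - p) * u `^ p.
Proof.
move=> a0 u0 r0 rp; have [ua|au] := leP u a.
  by rewrite ler_wpDr ?mulr_ge0 ?powR_ge0// ge0_ler_powR ?nnegrE// ltW.
apply: ler_wpDl; first exact: powR_ge0.
have u0' : 0 < u by exact: lt_trans au.
have -> : u `^ r = u `^ (r - p) * u `^ p.
  by rewrite -powRD ?subrK// (gt_eqF u0') implybT.
rewrite ler_pM2r ?powR_gt0// -(opprB p r) !powRN.
rewrite lef_pV2 ?posrE ?powR_gt0//.
by rewrite ge0_ler_powR ?nnegrE ?(ltW a0) ?(ltW u0') ?(ltW au) ?subr_ge0.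
Qed.

Lemma test_sqr F : test F ->
  exists2 Q, 0 <= Q & (\int[mu]_t (F t ^+ 2)%:E <= Q%:E)%E.
Proof.
move=> [mF [M FM] FJ]; exists (M ^+ 2); first exact: sqr_ge0.
apply: (@le_trans _ _ (\int[mu]_t ((M ^+ 2)%:E * (\1_J t)%:E))%E).
  apply: ge0_le_integral => //.
  - by move=> t _; rewrite lee_fin sqr_ge0.
  - by apply/measurable_EFinP; exact: measurable_funX.
  - by apply: measurable_funeM; exact/measurable_EFinP.
  move=> t _; rewrite -EFinM lee_fin indicE; have [_|] := boolP (t \in J).
    rewrite mulr1 -real_normK ?num_real// ler_pXn2r ?nnegrE//.
    exact: le_trans (FM t).
  by rewrite notin_setE => /FJ ->; rewrite expr0n mulr0.
rewrite ge0_integralZl_EFin ?sqr_ge0//; last exact/measurable_EFinP.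
by rewrite integral_indic// setIT muJ mule1.
Qed.

Lemma pair_sup_integral F M y a : test F -> 0 <= M -> (forall t, `|F t| <= M) ->
  0 < a -> `|y| < a -> (\int[mu]_t `|(F t * y t)%:E| <= (3 * M * a)%:E)%E.
Proof.
move=> tF M0 FM a0 ya; have [Q Q0 FQ] := test_sqr tF.
have ap : a `^ (1 - p) * a `^ p = a.
  by rewrite -powRD ?(gt_eqF a0) ?implybT// subrK powRr1// ltW.
apply: (le_trans (@pair_abs_le F y a (2 * M * a) (M * a `^ (1 - p)) 0 Q _ _ _ _ _ _ _ _)) => //.
- by rewrite !mulr_ge0// ltW.
- by rewrite !mulr_ge0// powR_ge0.
- move=> t u v _ va; rewrite mul0r addr0 normrM.
  have := young_le a0 (normr_ge0 u) ler01 p1R.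
  rewrite !powRr1 ?(ltW a0)// => h.
  apply: (@le_trans _ _ (M * (`|u| + `|v|))).
    by rewrite ler_pM// ler_normD.
  have -> : 2 * M * a + M * a `^ (1 - p) * `|u| `^ p =
    M * (2 * a + a `^ (1 - p) * `|u| `^ p) by ring.
  by rewrite ler_wpM2l//; lra.
- by rewrite mul0r addr0 -[M * _ * _]mulrA ap lee_fin; lra.
Qed.

Lemma integrable_pair F y : test F -> mu.-integrable setT (fun t => (F t * y t)%:E).
Proof.
move=> tF; have [mF [M FM] FJ] := tF.
apply/integrableP; split; first exact: measurable_pair.
apply: le_lt_trans (ltry (3 * Num.max 0 M * (`|y| + 1))).
apply: (@pair_sup_integral F (Num.max 0 M) y (`|y| + 1) tF).
- by rewrite le_max lexx.
- by move=> t; rewrite le_max FM orbT.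
- by rewrite ltr_wpDl.
- by rewrite ltrDl.
Qed.

Lemma pair_le_integral F y c : test F ->
  (\int[mu]_t `|(F t * y t)%:E| <= c%:E)%E -> `|pair F y| <= c.
Proof.
move=> tF h; have iF := integrable_pair y tF.
rewrite -lee_fin EFin_normr_Rintegral//.
apply: le_trans h; apply: le_abse_integral => //.
exact: measurable_pair (let: And3 m _ _ := tF in m).
Qed.

(** Decompositions are available only strictly above the norm; the bounds pass
    to the limit. *)
Lemma pair_le_limit F y a c : 0 <= a -> `|y| <= a ->
  (forall b, a < b -> `|pair F y| <= c * b) -> 0 <= c -> `|pair F y| <= c * a.
Proof.
move=> a0 ya H c0; apply/ler_addgt0Pr => e e0.
have e' : 0 < e / (c + 1) by rewrite divr_gt0// ltr_wpDl.
apply: (le_trans (H (a + e / (c + 1)) _)); first by rewrite ltrDl.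
rewrite mulrDr lerD2l mulrCA ler_piMr ?(ltW e0)//.
by rewrite ler_pdivrMr ?mul1r ?lerDl// ltr_wpDl.
Qed.

Lemma pair_sup F M y a : test F -> 0 <= M -> (forall t, `|F t| <= M) ->
  0 <= a -> `|y| <= a -> `|pair F y| <= 3 * M * a.
Proof.
move=> tF M0 FM a0 ya; apply: pair_le_limit => // [b ab|]; last by rewrite mulr_ge0.
apply: pair_le_integral => //; apply: pair_sup_integral => //.
  exact: le_lt_trans ab.
exact: le_lt_trans ab.
Qed.

(** For [2 <= p] the sum space restricted to a set of measure one embeds in
    [L_2]. *)
Lemma pair_sqr F S y a : 2 <= p -> test F -> 0 < S ->
  (\int[mu]_t (F t ^+ 2)%:E <= (S ^+ 2)%:E)%E ->
  0 <= a -> `|y| <= a -> `|pair F y| <= 4 * S * a.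
Proof.
move=> p2 tF S0 FS a0 ya.
apply: pair_le_limit => // [b ab|]; last by rewrite mulr_ge0// ltW.
have b0 : 0 < b by exact: le_lt_trans ab.
have bp : b `^ (2 - p) * b `^ p = b ^+ 2.
  by rewrite -powRD ?(gt_eqF b0) ?implybT// subrK powR_mulrn// ltW.
have bp0 : 0 < b `^ (2 - p) by exact: powR_gt0.
apply: pair_le_integral => //.
apply: (le_trans (@pair_abs_le F y b (2 * S * b) (S / b * b `^ (2 - p)) (b / (2 * S))
   (S ^+ 2) _ _ _ _ _ _ _ _)) => //.
- exact: le_lt_trans ab.
- by rewrite !mulr_ge0// ltW.
- by rewrite mulr_ge0 ?divr_ge0 ?ltW.
- by rewrite divr_ge0 ?mulr_ge0 ?ltW.
- move=> t u v _ vb; rewrite normrM.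
  have := young_le b0 (normr_ge0 u) (ler0n R 2) p2.
  rewrite !powR_mulrn ?(ltW b0)//; move: (`|u| `^ p) => up.
  have := ler_normD u v; rewrite -[F t ^+ 2]real_normK ?num_real//.
  move: (normr_ge0 (u + v)) (normr_ge0 (F t)) (normr_ge0 u) (normr_ge0 v) vb.
  move: (`|u + v|) (`|F t|) (`|u|) (`|v|) => m f q r m0 f0 q0 r0 rb mqr qup.
  have m2 : m ^+ 2 <= 4 * b ^+ 2 + 2 * (b `^ (2 - p) * up).
    have := sqr_ge0 (q - r); nra.
  have -> : 2 * S * b + S / b * b `^ (2 - p) * up + b / (2 * S) * f ^+ 2 =
     (S ^+ 2 * (4 * b ^+ 2 + 2 * (b `^ (2 - p) * up)) + b ^+ 2 * f ^+ 2) / (2 * S * b).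
    by field; rewrite !gt_eqF.
  rewrite ler_pdivlMr ?mulr_gt0//.
  have := sqr_ge0 (b * f - S * m).
  have := ler_wpM2l (sqr_ge0 S) m2; nra.
- rewrite -[S / b * _ * _]mulrA bp lee_fin.
  have -> : 2 * S * b + S / b * b ^+ 2 + b / (2 * S) * S ^+ 2 = 7 / 2 * S * b.
    by field; rewrite !gt_eqF.
  by rewrite ler_pM2r// ler_pM2r//; lra.
Qed.

Lemma pairDr F y z : test F -> pair F (y + z) = pair F y + pair F z.
Proof.
move=> tF; have [mF _ _] := tF.
rewrite /pair -RintegralD//; [|exact: integrable_pair|exact: integrable_pair].
congr fine; apply: ae_eq_integral => //.
- exact: measurable_pair.
- apply/measurable_EFinP; apply: measurable_funD; apply: measurable_funM => //.
- by apply: filterS (plusDE y z) => t tE _; rewrite [X in _ * X]tE mulrDr.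
Qed.

Lemma pairZr F c y : test F -> pair F (c *: y) = c * pair F y.
Proof.
move=> tF; have [mF _ _] := tF.
rewrite /pair -RintegralZl//; last exact: integrable_pair.
congr fine; apply: ae_eq_integral => //.
- exact: measurable_pair.
- by apply/measurable_EFinP; apply: measurable_funM => //; exact: measurable_funM.
- by apply: filterS (plusZE c y) => t tE _; rewrite [X in _ * X]tE mulrCA.
Qed.

Lemma pair_suml (N : nat) (F : 'I_N -> T -> R) (c : 'I_N -> R) y :
  (forall j, test (F j)) ->
  \sum_j c j * pair (F j) y = pair (fun t => \sum_j c j * F j t) y.
Proof.
move=> tF; rewrite /pair /Rintegral.
have iF j := integrable_pair y (tF j).
have -> : (\int[mu]_t ((\sum_j c j * F j t) * y t)%:E =
    \sum_(j < N) (c j)%:E * \int[mu]_t (F j t * y t)%:E)%E.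
  under eq_integral => t _.
    have -> : ((\sum_j c j * F j t) * y t)%:E =
        (\sum_(j < N) (c j)%:E * (F j t * y t)%:E)%E.
      rewrite mulr_suml -sumEFin; apply: eq_bigr => j _.
      by rewrite -EFinM mulrA.
    over.
  rewrite (integral_sum measurableT); last first.
    by move=> j; exact: (integrableZl measurableT _ (iF j)).
  by apply: eq_bigr => j _; rewrite (integralZl measurableT (iF j)).
have fin j : (\int[mu]_t (F j t * y t)%:E)%E \is a fin_num.
  exact: (integrable_fin_num _ (iF j)).
under [in RHS]eq_bigr do rewrite -[X in (_ * X)%E]fineK// -EFinM.
by rewrite sumEFin.
Qed.

End pairing.


(** * The two spaces are not isomorphic *)

Section rational_duality.
Context (R : realType) (N : nat).

(** The Euclidean norm is a supremum over rational vectors, hence over a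
    countable set. *)
Lemma rational_sqr_le (v : 'I_N -> R) (B : R) : 0 < B ->
  (forall (a : {ffun 'I_N -> rat}) (S : rat), 0 < S ->
     \sum_j (ratr (a j) : R) ^+ 2 <= ratr S ^+ 2 ->
     `|\sum_j ratr (a j) * v j| <= B * ratr S) ->
  \sum_j v j ^+ 2 <= B ^+ 2.
Proof.
move=> B0 H; rewrite leNgt; apply/negP; set V := \sum_j v j ^+ 2 => BV.
have V0 : 0 < V by apply: lt_trans BV; rewrite exprn_gt0.
have sV : Num.sqrt V < V / B.
  rewrite ltr_pdivlMr// -[ltRHS](sqr_sqrtr (ltW V0)) expr2 ltr_pM2l ?sqrtr_gt0//.
  by rewrite -(gtr0_norm B0) -sqrtr_sqr ltr_sqrt.
have [S] := rat_in_itvoo sV; rewrite in_itv/= => /andP[S1 S2].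
have S0 : 0 < ratr S :> R by apply: le_lt_trans S1; exact: sqrtr_ge0.
have VS : V < ratr S ^+ 2.
  by rewrite -[ltLHS](sqr_sqrtr (ltW V0)) ltr_pXn2r ?nnegrE ?sqrtr_ge0// ltW.
have BS : B * ratr S < V by rewrite mulrC -ltr_pdivlMr.
pose c : R := 2 * \sum_j `|v j| + N%:R + 1.
have sv0 : 0 <= \sum_j `|v j| by exact: sumr_ge0.
have c0 : 0 < c by rewrite /c ltr_wpDl// addr_ge0// mulr_ge0.
(* small enough for a rational vector within [e] of [v] to contradict [H] *)
pose e : R := Num.min 1 (Num.min ((ratr S ^+ 2 - V) / c) ((V - B * ratr S) / (2 * c))).
have e0 : 0 < e.
  by rewrite !lt_min ltr01 !divr_gt0 ?subr_gt0 ?mulr_gt0.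
have e1 : e <= 1 by rewrite ge_min lexx.
have eS : e * c <= ratr S ^+ 2 - V by rewrite -ler_pdivlMr// !ge_min lexx orbT.
have eB : e * c < V - B * ratr S.
  have : e * (2 * c) <= V - B * ratr S.
    by rewrite -ler_pdivlMr ?mulr_gt0// !ge_min lexx !orbT.
  have : 0 < e * c by rewrite mulr_gt0.
  lra.
have [a aP] : exists a : {ffun 'I_N -> rat}, forall j, v j - e < ratr (a j) < v j.
  suff /choice[a aP] : forall j, exists q : rat, v j - e < ratr q < v j.
    by exists [ffun j => a j] => j; rewrite ffunE.
  move=> j; have ve : v j - e < v j by rewrite ltrBlDr ltrDl.
  by have [q] := rat_in_itvoo ve; rewrite in_itv/=; exists q.
have ae j : `|ratr (a j) - v j| <= e.
  by rewrite ler_norml; have /andP[? ?] := aP j; apply/andP; split; lra.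
have av j : (ratr (a j) : R) ^+ 2 <= v j ^+ 2 + e * (2 * `|v j| + 1).
  have -> : (ratr (a j) : R) = v j + (ratr (a j) - v j) by ring.
  move: (ae j); move: (ratr (a j) - v j) => r re.
  have h1 : r ^+ 2 <= e.
    rewrite -real_normK ?num_real//; have := normr_ge0 r; nra.
  have h2 : v j * r <= `|v j| * e.
    by apply: (le_trans (ler_norm _)); rewrite normrM ler_wpM2l.
  have -> : (v j + r) ^+ 2 = v j ^+ 2 + 2 * (v j * r) + r ^+ 2 by ring.
  lra.
have S0' : 0 < S by rewrite -(ltr0q R).
have sum_a : \sum_j (ratr (a j) : R) ^+ 2 <= ratr S ^+ 2.
  apply: (@le_trans _ _ (V + e * c)); last by lra.
  apply: (@le_trans _ _ (\sum_j (v j ^+ 2 + e * (2 * `|v j| + 1)))).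
    exact: ler_sum.
  rewrite big_split/= -/V lerD2l -mulr_sumr ler_pM2l// big_split/= -mulr_sumr.
  by rewrite sumr_const card_ord /c; lra.
have := H a S S0' sum_a; apply/negP; rewrite -ltNge.
apply: lt_le_trans (ler_norm _); apply: (@lt_le_trans _ _ (V - e * c)); first by lra.
apply: (@le_trans _ _ (\sum_j (v j ^+ 2 - e * `|v j|))).
  rewrite big_split/= -/V lerD2l sumrN -mulr_sumr lerN2 ler_pM2l// /c.
  have : 0 <= N%:R :> R by []. lra.
apply: ler_sum => j _.
have -> : ratr (a j) * v j = v j ^+ 2 - (v j - ratr (a j)) * v j by ring.
rewrite lerD2l lerN2; apply: (le_trans (ler_norm _)).
by rewrite normrM ler_wpM2r// distrC.
Qed.

End rational_duality.

Section no_isomorphism.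
Local Open Scope classical_set_scope.
Context d (T : measurableType d) (R : realType).
Context (mu : {measure set T -> \bar R}) (p : R) (p1 : (1 <= p%:E)%E).
Local Notation Ip := (Ip mu p).
Local Notation X := (LpCapLoo mu p1).
Local Notation Y := (LpPlusLoo mu p1).

Let p1R : 1 <= p. Proof. by rewrite -lee_fin. Qed.
Let p0 : 0 < p. Proof. exact: lt_le_trans ltr01 p1R. Qed.

Context (J : set T) (mJ : measurable J) (muJ : mu J = 1%:E).
Context (w : nat -> T -> R).
Hypotheses (mw : forall n, measurable_fun setT (w n)).
Hypotheses (wJ : forall n t, ~ J t -> w n t = 0).
Hypotheses (w1 : forall n t, `|w n t| <= 1).
Hypothesis w_orth : forall n m,
  (\int[mu]_t (w n t * w m t)%:E)%E = ((n == m)%:R)%:E.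

Context (f : {linear Y -> X}) (g : {linear X -> Y}) (Cf Cg : R).
Hypotheses (fK : cancel f g) (Cf0 : 0 < Cf) (Cg0 : 0 < Cg).
Hypotheses (f_bound : forall y, `|f y| <= Cf * `|y|).
Hypotheses (g_bound : forall x, `|g x| <= Cg * `|x|).

Let test_w n : test J (w n).
Proof. by split=> //; [exists 1|exact: wJ]. Qed.

Let wvec n : Y := to_plus mu p1 (w n).
Let xvec n : X := f (wvec n).

Let wvecE n : \forall t \ae mu, wvec n t = w n t.
Proof.
apply: to_plusE => //.
have -> : w n = comb w (fun _ : 'I_1 => n) (fun=> 1).
  by apply/funext => t; rewrite /comb big_ord1 mul1r.
apply: le_lt_trans (Ip_comb p1R mJ muJ mw wJ w1 w_orth _ (S := 1) ltr01 _) (ltry _).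
  by move=> i j _; rewrite !ord1.
by rewrite big_ord1.
Qed.

Lemma cap_sumE (I : Type) (s : seq I) (F : I -> X) :
  \forall t \ae mu, (\sum_(i <- s) F i) t = \sum_(i <- s) F i t.
Proof.
elim: s => [|i s IH].
  by rewrite big_nil; apply: filterS (L0_zeroE mu) => t tE; rewrite big_nil [LHS]tE.
rewrite big_cons; have A := capDE (F i) (\sum_(j <- s) F j).
by apply: filterS2 A IH => t -> tE; rewrite big_cons; congr (_ + _).
Qed.

Lemma plus_sumE (I : Type) (s : seq I) (F : I -> Y) :
  \forall t \ae mu, (\sum_(i <- s) F i) t = \sum_(i <- s) F i t.
Proof.
elim: s => [|i s IH].
  by rewrite big_nil; apply: filterS (L0_zeroE mu) => t tE; rewrite big_nil [LHS]tE.
rewrite big_cons; have A := plusDE (F i) (\sum_(j <- s) F j).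
by apply: filterS2 A IH => t -> tE; rewrite big_cons; congr (_ + _).
Qed.

Lemma ae_forall_fin (I : finType) (P : I -> T -> Prop) :
  (forall i, \forall t \ae mu, P i t) -> \forall t \ae mu, forall i, P i t.
Proof.
move=> H; pose Q k t := if unpickle k is Some i then P i t else True.
have : \forall t \ae mu, forall k, Q k t.
  apply: ae_foralln => k; rewrite /Q; case: unpickle => [i|]; first exact: H.
  exact: nearW.
by apply: filterS => t Qt i; have := Qt (pickle i); rewrite /Q pickleK.
Qed.

Section family.
Context (N : nat) (n : 'I_N -> nat) (n_inj : injective n).

(** The images of the system inherit an upper estimate by the Euclidean norm of
    the coefficients. *)
Lemma norm_comb_xvec (a : 'I_N -> R) S : 0 < S -> \sum_j a j ^+ 2 <= S ^+ 2 ->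
  `|\sum_j a j *: xvec (n j)| <= Cf * (euclid_Lp_cst p N * S).
Proof.
move=> S0 aS.
have -> : \sum_j a j *: xvec (n j) = f (\sum_j a j *: wvec (n j)).
  by rewrite linear_sum; apply: eq_bigr => j _; rewrite linearZ.
apply: (le_trans (f_bound _)); rewrite ler_wpM2l ?(ltW Cf0)//.
apply: (@plus_norm_le _ _ _ _ _ _ _ (comb w n a)).
- apply: mulr_ge0; last exact: ltW.
  by rewrite /euclid_Lp_cst; case: ifP => // _; exact: powR_ge0.
- exact: measurable_comb.
- have A := plus_sumE (index_enum 'I_N) (fun j => a j *: wvec (n j)).
  have B : \forall t \ae mu, forall j, (a j *: wvec (n j)) t = a j * w (n j) t.
    apply: ae_forall_fin => j.
    apply: filterS2 (plusZE (a j) (wvec (n j))) (wvecE (n j)) => t -> tE.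
    by congr (_ * _).
  apply: filterS2 A B => t -> tB; rewrite /comb; apply: eq_bigr => j _.
  exact: tB.
- exact: (Ip_comb p1R mJ muJ mw wJ w1 w_orth n_inj S0 aS).
Qed.

Lemma comb_xvecE (a : 'I_N -> R) : \forall t \ae mu,
  (\sum_j a j *: xvec (n j)) t = \sum_j a j * xvec (n j) t.
Proof.
have A := cap_sumE (index_enum 'I_N) (fun j => a j *: xvec (n j)).
have B : \forall t \ae mu, forall j, (a j *: xvec (n j)) t = a j * xvec (n j) t.
  by apply: ae_forall_fin => j; exact: capZE.
by apply: filterS2 A B => t -> tB; apply: eq_bigr => j _; exact: tB.
Qed.

(** An upper estimate by the Euclidean norm in [L_infty] is a pointwise bound of
    the square function. *)
Lemma ae_xvec_sqr : (0 < N)%N ->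
  \forall t \ae mu, \sum_j xvec (n j) t ^+ 2 <= (Cf * euclid_Lp_cst p N) ^+ 2.
Proof.
move=> N0; have k0 := euclid_Lp_cst_gt0 p N0.
have H : \forall t \ae mu, forall k : nat,
    if @unpickle ({ffun 'I_N -> rat} * rat)%type k is Some (a, z) then
      0 < z -> \sum_j (ratr (a j) : R) ^+ 2 <= ratr z ^+ 2 ->
      `|\sum_j ratr (a j) * xvec (n j) t| <= (Cf * euclid_Lp_cst p N) * ratr z
    else True.
  apply: ae_foralln => k; case: unpickle => [[a z]|]; last exact: nearW.
  have [z0|] := boolP ((0 : rat) < z); last by move=> /negP nS; apply: nearW => t.
  have [aS|] := boolP (\sum_j (ratr (a j) : R) ^+ 2 <= ratr z ^+ 2); last first.
    by move=> /negP nS; apply: nearW => t.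
  have [A _] := cap_normP (\sum_j ratr (a j) *: xvec (n j)).
  apply: filterS2 A (comb_xvecE (ratr \o a)) => t tA tB _ _.
  rewrite -[X in `|X|]tB; apply: (le_trans tA).
  by rewrite -mulrA; apply: norm_comb_xvec; rewrite ?ltr0q.
apply: filterS H => t Ht; apply: rational_sqr_le; first by rewrite mulr_gt0.
by move=> a S S0 aS; have := Ht (pickle (a, S)); rewrite pickleK; exact.
Qed.

End family.

(* The functional on functions that the inverse isomorphism and the pairing with
   [w n] induce; it is biorthogonal to the images of the system. *)
Let bfun n (h : T -> R) : R := pair (w n) (g (to_cap mu p1 h)).

Lemma test_comb N (n : 'I_N -> nat) c : test J (comb w n c).
Proof.
split; first exact: measurable_comb.
  by exists (\sum_j `|c j|) => t; exact: comb_le_sum.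
by move=> t; exact: comb_supp.
Qed.

Lemma bfun_lin n : cap_linear mu p (bfun n).
Proof.
split=> [h k hh hk|c h hh]; rewrite /bfun.
  by rewrite to_capD// linearD (pairDr mJ muJ _ _ (test_w n)).
by rewrite to_capZ// linearZ/= (pairZr mJ muJ _ _ (test_w n)).
Qed.

Lemma bfun_comb N (n : 'I_N -> nat) c h :
  \sum_j c j * bfun (n j) h = pair (comb w n c) (g (to_cap mu p1 h)).
Proof. by rewrite /bfun (pair_suml mJ muJ)// => j; exact: test_w. Qed.

Let J_point : exists t, J t.
Proof.
apply: contrapT => nJ; have J0 : J = set0.
  by apply/seteqP; split=> // t Jt; apply: nJ; exists t.
by move: muJ; rewrite J0 measure0 => /eqP; rewrite eqe eq_sym oner_eq0.
Qed.

Let cap_ball_pos a h : cap_ball mu p a h -> 0 <= a.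
Proof. by have [t _] := J_point; move=> ah; exact: cap_ball_ge0 ah t. Qed.

Let g_norm a h : cap_ball mu p a h -> `|g (to_cap mu p1 h)| <= Cg * a.
Proof.
move=> ah; apply: (le_trans (g_bound _)); rewrite ler_pM2l//.
exact: to_cap_norm (cap_ball_pos ah) ah.
Qed.

Lemma bfun_sup N (n : 'I_N -> nat) c M a h : 0 <= M ->
  (forall t, `|comb w n c t| <= M) -> cap_ball mu p a h ->
  `|\sum_j c j * bfun (n j) h| <= 3 * M * (Cg * a).
Proof.
move=> M0 cM ah; rewrite bfun_comb; apply: (pair_sup mJ muJ) => //.
- exact: test_comb.
- by rewrite mulr_ge0 ?(ltW Cg0)// (cap_ball_pos ah).
- exact: g_norm.
Qed.

Lemma bfun_bound n a h : cap_ball mu p a h -> `|bfun n h| <= 3 * Cg * a.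
Proof.
move=> ah; have := @bfun_sup 1 (fun=> n) (fun=> 1) 1 a h ler01 _ ah.
rewrite big_ord1 mul1r mulr1 mulrA; apply => t.
by rewrite /comb big_ord1 mul1r.
Qed.

Lemma bfun_sqr N (n : 'I_N -> nat) c S a h : 2 <= p -> injective n -> 0 < S ->
  \sum_j c j ^+ 2 <= S ^+ 2 -> cap_ball mu p a h ->
  `|\sum_j c j * bfun (n j) h| <= 4 * S * (Cg * a).
Proof.
move=> p2 n_inj S0 cS ah; rewrite bfun_comb; apply: (pair_sqr mJ muJ) => //.
- exact: test_comb.
- by rewrite (integral_comb_sqr mJ muJ mw wJ w1 w_orth n_inj) lee_fin.
- by rewrite mulr_ge0 ?(ltW Cg0)// (cap_ball_pos ah).
- exact: g_norm.
Qed.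

Let block_inj l q : injective (fun j : 'I_(16 ^ l) => (q * 16 ^ l + j)%N).
Proof. by move=> i j /addnI/val_inj. Qed.

(** The bounds that hold almost everywhere are countably many, so that changing
    the images of the system on a null set makes them hold everywhere. *)
Lemma good_versions : exists x : nat -> T -> R,
  [/\ forall n, cap_ball mu p (Cf * euclid_Lp_cst p 1) (x n),
      forall n, \forall t \ae mu, xvec n t = x n t &
      forall l q t, \sum_(j < 16 ^ l) x (q * 16 ^ l + j)%N t ^+ 2 <=
        (Cf * euclid_Lp_cst p (16 ^ l)) ^+ 2].
Proof.
have norm1 n : `|xvec n| <= Cf * euclid_Lp_cst p 1.
  have := @norm_comb_xvec 1 (fun=> n) _ (fun=> 1) 1 ltr01.
  rewrite !big_ord1 scale1r mulr1; apply; last by rewrite expr1n.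
  by move=> i j _; rewrite !ord1.
have C0 : 0 <= Cf * euclid_Lp_cst p 1 by rewrite ltW// mulr_gt0// euclid_Lp_cst_gt0.
have [Z [mZ Z0 ZP]] : \forall t \ae mu, (forall n, `|xvec n t| <= Cf * euclid_Lp_cst p 1) /\
    (forall l q, \sum_(j < 16 ^ l) xvec (q * 16 ^ l + j)%N t ^+ 2 <=
       (Cf * euclid_Lp_cst p (16 ^ l)) ^+ 2).
  apply: filterS2 (_ : \forall t \ae mu, forall n, `|xvec n t| <= Cf * euclid_Lp_cst p 1)
   (_ : \forall t \ae mu, forall l q,
    \sum_(j < 16 ^ l) xvec (q * 16 ^ l + j)%N t ^+ 2 <= (Cf * euclid_Lp_cst p (16 ^ l)) ^+ 2).
  - by move=> t.
  - apply: ae_foralln => n; have [A _] := cap_normP (xvec n).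
    by apply: filterS A => t /le_trans; exact.
  - apply: ae_foralln => l; apply: ae_foralln => q.
    by apply: (ae_xvec_sqr (@block_inj l q)); rewrite expn_gt0.
pose x n t := \1_(~` Z) t * xvec n t.
have mZC : measurable (~` Z) by exact: measurableC.
have xE n : \forall t \ae mu, xvec n t = x n t.
  exists Z; split=> // t /= nE; apply: contrapT => nZ; apply: nE.
  by rewrite /x indicE mem_set// mul1r.
have mx n : measurable_fun setT (x n).
  by apply: measurable_funM => //; exact: measurable_L0.
exists x; split=> // [n|l q t].
  split=> // [t|].
    rewrite /x indicE; have [|_] := boolP (t \in ~` Z); last by rewrite mul0r normr0.
    rewrite inE mul1r => nZ; have [//|nP] := leP `|xvec n t| (Cf * euclid_Lp_cst p 1).
    by exfalso; apply: nZ; apply: ZP => -[/(_ n)]; rewrite leNgt nP.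
  have [_ I] := cap_normP (xvec n).
  rewrite -(eq_Ip_ae p (measurable_L0 _) (mx n) (xE n)).
  apply: (le_trans I); rewrite lee_fin ge0_ler_powR ?nnegrE//; exact: ltW.
have [Zt|nZ] := pselect (Z t).
  by rewrite big1 ?sqr_ge0// => j _; rewrite /x indicE memNset ?mul0r ?expr0n//.
rewrite (eq_bigr (fun j : 'I_(16 ^ l) => xvec (q * 16 ^ l + j)%N t ^+ 2)); last first.
  by move=> j _; rewrite /x indicE mem_set// mul1r.
rewrite leNgt; apply/negP => lt; apply: nZ; apply: ZP => -[_ /(_ l q)].
by rewrite leNgt lt.
Qed.

Context (h : forall l, 'I_(16 ^ l) -> 'I_(16 ^ l) -> R).
Hypotheses (h1 : forall l j c, `|@h l j c| <= 1).
Hypothesis wh : forall l q t, exists (c : 'I_(16 ^ l)) (u : R), `|u| <= 1 /\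
  forall j : 'I_(16 ^ l), w (q * 16 ^ l + j)%N t = u * h j c.
Context (E : nat -> set T).
Hypotheses (mE : forall m, measurable (E m)) (ndE : nondecreasing_seq E).
Hypotheses (coverE : forall t, exists m, E m t).
Hypotheses (finE : forall m, (mu (E m) < +oo)%E).

(** On a block the random sums of [w] take only as many values, up to sign, as
    there are terms; the fourth moment then makes their supremum much smaller
    than the number of terms. *)
Definition block_sup l (e : {ffun 'I_(16 ^ l) -> bool}) : R :=
  8 ^+ l + \sum_(c < 16 ^ l) ((8 ^+ l) ^+ 3)^-1 * (\sum_j h j c * sgn R e j) ^+ 4.

Lemma comb_block_sup l q e t :
  `|comb w (fun j : 'I_(16 ^ l) => (q * 16 ^ l + j)%N) (sgn R e) t| <= block_sup e.
Proof.
have [c [u [u1 wE]]] := wh l q t.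
have -> : comb w (fun j : 'I_(16 ^ l) => (q * 16 ^ l + j)%N) (sgn R e) t =
    u * \sum_j h j c * sgn R e j.
  rewrite /comb mulr_sumr; apply: eq_bigr => j _; rewrite wE; ring.
rewrite normrM; set z := \sum_j _.
have e8 : 0 < 8 ^+ l :> R by rewrite exprn_gt0.
apply: (@le_trans _ _ `|z|); first by rewrite ler_piMl.
have : `|z| <= 8 ^+ l + ((8 ^+ l) ^+ 3)^-1 * z ^+ 4.
  have -> : z ^+ 4 = `|z| ^+ 4 by rewrite -normrX ger0_norm// exprn_even_ge0.
  have [zM|/ltW Mz] := leP `|z| (8 ^+ l).
    by rewrite ler_wpDr// mulr_ge0 ?invr_ge0 ?exprn_ge0// ltW.
  apply: ler_wpDl; first exact: ltW.
  by rewrite ler_pdivlMl ?exprn_gt0// [`|z| ^+ 4]exprSr ler_wpM2r// ler_pXn2r ?nnegrE//.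
move=> /le_trans; apply; rewrite /block_sup lerD2l (bigD1 c)//= lerDl.
by apply: sumr_ge0 => b _; rewrite mulr_ge0 ?exprn_even_ge0.
Qed.

Lemma mean_block_sup l : mean (@block_sup l) <= 4 * 8 ^+ l.
Proof.
have e8 : 0 < 8 ^+ l :> R by rewrite exprn_gt0.
rewrite /block_sup meanD mean_cst mean_sum.
suff : \sum_(c < 16 ^ l) mean (fun e => ((8 ^+ l) ^+ 3)^-1 *
    (\sum_j h j c * sgn R e j) ^+ 4) <= 3 * 8 ^+ l by lra.
pose N : R := 16 ^+ l; have N0 : 0 < N by rewrite exprn_gt0.
have NE : (16 ^ l)%:R = N by rewrite natrX.
apply: (@le_trans _ _ (\sum_(c < 16 ^ l) ((8 ^+ l) ^+ 3)^-1 * (3 * N ^+ 2))).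
  apply: ler_sum => c _; rewrite meanZ ler_pM2l ?invr_gt0 ?exprn_gt0//.
  apply: (le_trans (mean_sgn_sum_pow4 _)); rewrite ler_pM2l//.
  have hN : \sum_j h j c ^+ 2 <= N.
    apply: (@le_trans _ _ (\sum_(j < 16 ^ l) 1)).
      apply: ler_sum => j _; rewrite -real_normK ?num_real//.
      by rewrite expr_le1.
    by rewrite sumr_const card_ord NE.
  rewrite ler_pXn2r ?nnegrE ?(ltW N0)//.
  by apply: sumr_ge0 => j _; exact: sqr_ge0.
rewrite sumr_const card_ord -[_ *+ _]mulr_natl NE.
have -> : N * (((8 ^+ l) ^+ 3)^-1 * (3 * N ^+ 2)) = 3 * (N ^+ 3 / (8 ^+ l) ^+ 3).
  ring.
suff -> : N ^+ 3 = (8 ^+ l) ^+ 3 * 8 ^+ l by rewrite mulrAC mulfV ?mul1r// expf_neq0// gt_eqF.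
rewrite /N -!exprM -exprD -[16]/((2 ^ 4)%:R) -[8]/((2 ^ 3)%:R) !natrX -!exprM.
by congr (_ ^+ _); lia.
Qed.

Let block_s l : R := Cf * euclid_Lp_cst p (16 ^ l).

Let block_s_gt0 l : 0 < block_s l.
Proof. by rewrite mulr_gt0// euclid_Lp_cst_gt0// expn_gt0. Qed.

Let block_L l : R := if p <= 2 then 3 * Cg * (4 * 8 ^+ l) else 4 * Cg * 4 ^+ l.

Let block_Lam l (e : {ffun 'I_(16 ^ l) -> bool}) : R :=
  if p <= 2 then 3 * Cg * block_sup e else 4 * Cg * 4 ^+ l.

Let block_Lam_mean l : mean (@block_Lam l) <= block_L l.
Proof.
rewrite /block_Lam /block_L; case: ifP => _; last by rewrite mean_cst.
by rewrite meanZ ler_wpM2l ?mean_block_sup// mulr_ge0// ltW.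
Qed.

Let block_Lam_bound l q (e : {ffun 'I_(16 ^ l) -> bool}) a k :
  cap_ball mu p a k ->
  \sum_(j < 16 ^ l) sgn R e j * bfun (q * 16 ^ l + j)%N k <= block_Lam e * a.
Proof.
move=> ak; apply: (le_trans (ler_norm _)); rewrite /block_Lam.
case: (leP p 2) => p2.
  have e0 : 0 <= block_sup e.
    have [t _] := J_point; apply: le_trans (comb_block_sup 0 e t); exact: normr_ge0.
  apply: (le_trans (bfun_sup e0 (comb_block_sup q e) ak)).
  by have -> : 3 * block_sup e * (Cg * a) = 3 * Cg * block_sup e * a by ring.
have := @bfun_sqr _ (fun j : 'I_(16 ^ l) => (q * 16 ^ l + j)%N) (sgn R e) (4 ^+ l)
  a k (ltW p2) (@block_inj l q) _ _ ak.
have -> : 4 * 4 ^+ l * (Cg * a) = 4 * Cg * 4 ^+ l * a by ring.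
apply; first by rewrite exprn_gt0.
under eq_bigr do rewrite expr2 sgnM.
rewrite sumr_const card_ord natrX -exprM mulnC exprM.
by have -> : (4 ^+ 2 : R) = 16 by ring.
Qed.

Let block_small eta : 0 < eta ->
  exists l0, forall l, (l0 <= l)%N -> block_s l * block_L l <= eta * (16 ^ l)%:R.
Proof.
move=> eta0; rewrite /block_s /block_L /euclid_Lp_cst; case: (leP p 2) => p2.
  have [k kP] := expr16_unbounded ((24 * Cf * Cg) / eta).
  exists (4 * k)%N => l kl.
  have k2 : (16 ^ k)%:R <= 2 ^+ l :> R.
    by rewrite natrX -[16]/((2 ^ 4)%:R) natrX -exprM ler_eXn2l// ltr1n.
  have -> : (16 ^ l)%:R = 2 ^+ l * 8 ^+ l :> R.
    by rewrite natrX -exprMn; congr (_ ^+ _); ring.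
  have -> : Cf * 2 * (3 * Cg * (4 * 8 ^+ l)) = 24 * Cf * Cg * 8 ^+ l by ring.
  rewrite mulrA ler_pM2r ?exprn_gt0// -ler_pdivrMl// mulrC.
  exact: le_trans (ltW kP) k2.
have [k kP] := expr16_unbounded ((4 * Cf * Cg / eta) `^ p).
exists k => l kl; set N : R := (16 ^ l)%:R.
have N0 : 0 < N by rewrite ltr0n expn_gt0.
have kN : (16 ^ k)%:R <= N by rewrite ler_nat leq_exp2l.
have c0 : 0 <= 4 * Cf * Cg / eta by rewrite !mulr_ge0 ?invr_ge0 ?ltW.
have cN : 4 * Cf * Cg / eta <= N `^ (1 / p).
  have : ((4 * Cf * Cg / eta) `^ p) `^ (1 / p) <= N `^ (1 / p).
    rewrite ge0_ler_powR ?nnegrE ?divr_ge0 ?powR_ge0 ?(ltW p0) ?(ltW N0)//.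
    exact: le_trans (ltW kP) kN.
  by rewrite -powRrM mul1r mulfV ?gt_eqF// powRr1.
have sN : 4 ^+ l = N `^ (1 / 2).
  rewrite mul1r powR12_sqrt ?(ltW N0)// /N natrX -[16]/((4 ^ 2)%:R) natrX.
  by rewrite exprAC sqrtr_sqr ger0_norm// exprn_ge0.
rewrite sN.
have -> : Cf * N `^ (1 / 2 - 1 / p) * (4 * Cg * N `^ (1 / 2)) =
    (4 * Cf * Cg) * (N `^ (1 / 2 - 1 / p) * N `^ (1 / 2)) by ring.
rewrite -powRD ?(gt_eqF N0) ?implybT//.
have NE : N = N `^ (1 / 2 - 1 / p + 1 / 2) * N `^ (1 / p).
  rewrite -powRD ?(gt_eqF N0) ?implybT//.
  have -> : 1 / 2 - 1 / p + 1 / 2 + 1 / p = 1 by field; rewrite gt_eqF.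
  by rewrite powRr1// ltW.
rewrite [in leRHS]NE mulrCA mulrC ler_pM2l ?powR_gt0// -ler_pdivrMl// mulrC.
exact: cN.
Qed.

(** For [p <= 2] the square functions on a block are bounded by a constant and
    the random functionals by the supremum of random sums, that is by
    [(16 ^ l) ^ (3/4)]. For [2 < p] the functionals satisfy the sharper [L_2]
    bound [(16 ^ l) ^ (1/2)], which leaves room for square functions of order
    [(16 ^ l) ^ (1/2 - 1/p)]. Either way the product is negligible before the size
    of the block, and humps exist. *)
Lemma no_isomorphism : p != 2 -> False.
Proof.
move=> p_neq2; have [x [x_ball xE x_block]] := good_versions.
pose C := Num.max (Cf * euclid_Lp_cst p 1) (3 * Cg).
have C0 : 0 < C by rewrite /C lt_max; apply/orP; right; rewrite mulr_gt0.
have C1 : 0 <= Cf * euclid_Lp_cst p 1 by rewrite ltW// mulr_gt0// euclid_Lp_cst_gt0.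
have xC n : cap_ball mu p C (x n).
  have [mx xn In] := x_ball n; split=> // [t|].
    by rewrite (le_trans (xn t))// le_max lexx.
  apply: (le_trans In); rewrite lee_fin ge0_ler_powR ?nnegrE ?(ltW p0) ?(ltW C0)//.
  by rewrite le_max lexx.
have b_bound n a k : cap_ball mu p a k -> `|bfun n k| <= C * a.
  move=> ak; apply: (le_trans (bfun_bound n ak)).
  by rewrite ler_wpM2r ?(cap_ball_pos ak)// le_max lexx orbT.
have bx n : bfun n (x n) = 1.
  have -> : bfun n (x n) = pair (w n) (wvec n).
    rewrite /bfun (_ : to_cap mu p1 (x n) = xvec n) ?fK//.
    have hx : in_cap mu p (x n) by exists C.
    by apply: ae_eq_cap; apply: filterS2 (to_capE p1 hx) (xE n) => t -> <-.
  rewrite /pair /Rintegral.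
  have -> : (\int[mu]_t (w n t * wvec n t)%:E = 1%:E)%E; last by [].
  have := w_orth n n; rewrite eqxx => <-.
  apply: ae_eq_integral => //.
  - exact: measurable_pair.
  - by apply/measurable_EFinP; exact: measurable_funM.
  - by apply: filterS (wvecE n) => t tE _; rewrite [X in _ * X]tE.
have [c c0 humps] := hump_exists p1R mE ndE coverE finE C0 xC bfun_lin b_bound bx
  block_s_gt0 x_block block_Lam_bound block_Lam_mean block_small.
have [n [A [n_inj mA tA IA bA]]] := hump_sequence mE ndE humps.
have [p_lt2|p_gt2|/eqP] := ltgtP p 2; last by rewrite (negbTE p_neq2).
- apply: (no_humps_lt2 p1R mA tA p_lt2 c0 (B := (2 * Cf) `^ p) _ IA).
    by move=> k; have [] := xC k.
  move=> K e; have [K0|K0] := posnP K.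
    have -> : Ip (fun t => \sum_(k < K) x (n k) t * sgn R e k) = 0%E; last first.
      by rewrite lee_fin mulr_ge0// powR_ge0.
    rewrite Ip.unlock (eq_integral (cst 0%E)) ?integral0// => t _.
    rewrite big1 ?normr0 ?powR0 ?gt_eqF// => j _.
    by have := ltn_ord j; rewrite {2}K0.
  have nK : injective (fun k : 'I_K => n k) by move=> i j /n_inj/val_inj.
  have [_ I] := cap_normP (\sum_(k < K) sgn R e k *: xvec (n k)).
  have S0 : 0 < Num.sqrt K%:R :> R by rewrite sqrtr_gt0 ltr0n.
  have -> : Ip (fun t => \sum_(k < K) x (n k) t * sgn R e k) =
      Ip (\sum_(k < K) sgn R e k *: xvec (n k)).
    apply: eq_Ip_ae; last first.
    + have xA : \forall t \ae mu, forall k : 'I_K, xvec (n k) t = x (n k) t.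
        by apply: ae_forall_fin => k; exact: xE.
      apply: filterS2 (comb_xvecE (fun k : 'I_K => n k) (sgn R e)) xA => t -> xA.
      by apply: eq_bigr => k _; rewrite xA mulrC.
    + exact: measurable_L0.
    + by apply: measurable_sum => k; apply: measurable_funM => //; have [] := xC (n k).
  apply: (le_trans I); rewrite lee_fin.
  have -> : (2 * Cf) `^ p * K%:R `^ (p / 2) = (Cf * (2 * Num.sqrt K%:R)) `^ p.
    rewrite -powR12_sqrt// mulrA [2 * Cf]mulrC [RHS]powRM ?mulr_ge0 ?powR_ge0 ?(ltW Cf0)//.
    by rewrite -powRrM mulrC [2^-1 * p]mulrC.
  rewrite ge0_ler_powR ?nnegrE ?(ltW p0) ?mulr_ge0 ?(ltW Cf0) ?(ltW S0)//.
  have := @norm_comb_xvec K _ nK (sgn R e) _ S0; rewrite /euclid_Lp_cst (ltW p_lt2); apply.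
  under eq_bigr do rewrite expr2 sgnM.
  by rewrite sumr_const card_ord sqr_sqrtr.
- apply: (no_humps_gt2 p1R mA tA (B := 4 * Cg) (C := C) p_gt2 C0 bfun_lin xC bA).
  move=> K e a k ak; have [K0|K0] := posnP K.
    rewrite big1; last by move=> j _; have := ltn_ord j; rewrite {2}K0.
    by rewrite !mulr_ge0 ?powR_ge0 ?(cap_ball_pos ak)// ltW.
  apply: (le_trans (ler_norm _)).
  have nK : injective (fun k : 'I_K => n k) by move=> i j /n_inj/val_inj.
  have S0 : 0 < Num.sqrt K%:R :> R by rewrite sqrtr_gt0 ltr0n.
  have -> : 4 * Cg * K%:R `^ (1 / 2) * a = 4 * Num.sqrt K%:R * (Cg * a).
    by rewrite mul1r powR12_sqrt//; ring.
  apply: bfun_sqr => //; first exact: ltW.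
  under eq_bigr do rewrite expr2 sgnM.
  by rewrite sumr_const card_ord sqr_sqrtr.
Qed.

End no_isomorphism.


(** * Walsh functions *)

Section binary_digits.
Local Open Scope nat_scope.

Definition bit (n i : nat) : bool := odd (n %/ 2 ^ i).

Lemma bit0 n : bit n 0 = odd n.
Proof. by rewrite /bit divn1. Qed.

Lemma bitS n i : bit n i.+1 = bit n./2 i.
Proof. by rewrite /bit expnS divnMA divn2. Qed.

Lemma bit_small n i : n < 2 ^ i -> bit n i = false.
Proof. by move=> ni; rewrite /bit divn_small. Qed.

Lemma bit_inj k n m : n < 2 ^ k -> m < 2 ^ k ->
  (forall i, i < k -> bit n i = bit m i) -> n = m.
Proof.
elim: k n m => [|k IH] n m; first by rewrite expn0; lia.
rewrite expnS => nk mk nm.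
have half : n./2 = m./2.
  apply: IH; [lia|lia|move=> i ik; rewrite -!bitS; exact: nm].
have := nm 0 isT; rewrite !bit0 => odd_eq.
by rewrite -[n]odd_double_half -[m]odd_double_half odd_eq half.
Qed.

Lemma bit_exists k (dg : nat -> bool) :
  exists2 c, c < 2 ^ k & forall i, i < k -> bit c i = dg i.
Proof.
elim: k dg => [|k IH] dg; first by exists 0.
have [c ck cdg] := IH (fun i => dg i.+1).
exists (dg 0 + c.*2); first by rewrite expnS; case: (dg 0); lia.
move=> [|i] ik; first by rewrite bit0 oddD odd_double addbF oddb.
by rewrite bitS half_bit_double cdg.
Qed.

Lemma bit_block k q j i : j < 2 ^ k ->
  bit (q * 2 ^ k + j) i = bit (q * 2 ^ k) i (+) bit j i.
Proof.
move=> jk; rewrite /bit; have [ik|ki] := ltnP i k.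
  have -> : q * 2 ^ k = q * 2 ^ (k - i) * 2 ^ i by rewrite -mulnA -expnD subnK// ltnW.
  by rewrite divnMDl ?expn_gt0// oddD mulnK ?expn_gt0.
have -> : 2 ^ i = 2 ^ k * 2 ^ (i - k) by rewrite -expnD subnKC.
rewrite !divnMA divnMDl ?expn_gt0// mulnK ?expn_gt0// [j %/ _]divn_small//.
by rewrite addn0 div0n addbF.
Qed.

End binary_digits.

Section walsh.
Context (R : realType).
Implicit Types (n k : nat) (dg : nat -> bool).

(** The Walsh function of index [n], as a function of the binary digits of the
    point; the factors of index [n] and beyond would be trivial since
    [n < 2 ^ n]. *)
Definition walsh n dg : R := \prod_(i < n) (-1) ^+ (bit n i && dg i).

Lemma walsh_trunc n K dg : (n < 2 ^ K)%N ->
  walsh n dg = \prod_(i < K) (-1) ^+ (bit n i && dg i).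
Proof.
move=> nK; rewrite /walsh.
have widen A B : (A <= B)%N -> (n < 2 ^ A)%N ->
    \prod_(i < A) (-1) ^+ (bit n i && dg i) =
    \prod_(i < B) (-1) ^+ (bit n i && dg i) :> R.
  move=> AB nA; rewrite -!(big_mkord xpredT (fun i => (-1) ^+ (bit n i && dg i))).
  rewrite [RHS](big_cat_nat (leq0n A) AB)/= [X in _ * X]big_nat_cond.
  rewrite [X in _ * X]big1 ?mulr1//.
  move=> i /andP[/andP[Ai _] _]; rewrite bit_small//.
  by apply: leq_trans nA _; rewrite leq_exp2l.
have [Kn|nK'] := leqP K n; first exact/esym/(widen K n Kn nK).
exact: (widen n K (ltnW nK') (ltn_expl n (isT : 1 < 2)%N)).
Qed.

(** A block of indices is a translate of the first block: there is no carry. *)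
Lemma walshM k q j dg : (j < 2 ^ k)%N ->
  walsh (q * 2 ^ k + j) dg = walsh (q * 2 ^ k) dg * walsh j dg.
Proof.
move=> jk; pose K := (q * 2 ^ k + j)%N.
have KK : (K < 2 ^ K)%N by exact: ltn_expl.
rewrite !(@walsh_trunc _ K) ?(leq_ltn_trans _ KK) ?leq_addr ?leq_addl//.
rewrite -big_split/=; apply: eq_bigr => i _; rewrite bit_block//.
by case: (bit _ i); case: (bit j i); case: (dg i); rewrite /= ?mulr1 ?mul1r ?mulrNN ?mulr1.
Qed.

Lemma normr_walsh n dg : `|walsh n dg| = 1.
Proof.
rewrite /walsh normr_prod big1// => i _; by rewrite normrX normrN1 expr1n.
Qed.

Lemma eq_walsh k n dg dg' : (n < 2 ^ k)%N ->
  (forall i, (i < k)%N -> dg i = dg' i) -> walsh n dg = walsh n dg'.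
Proof.
move=> nk E; rewrite !(walsh_trunc _ nk).
by apply: eq_bigr => i _; rewrite E.
Qed.

End walsh.

Section dyadic.
Local Open Scope classical_set_scope.
Context d (T : measurableType d) (R : realType).
Context (mu : {measure set T -> \bar R}).
Context (D : nat -> nat -> set T) (B : nat -> set T).
Hypotheses (mD : forall m v, measurable (D m v)) (mB : forall m, measurable (B m)).
Hypothesis muD : forall m v, (v < 2 ^ m)%N -> mu (D m v) = ((2 ^+ m)^-1)%:E.
Hypothesis D_split : forall m v, D m v = D m.+1 v.*2 `|` D m.+1 v.*2.+1.
Hypothesis DB : forall m v, D m.+1 v.*2.+1 `<=` B m.
Hypothesis DnB : forall m v, D m.+1 v.*2 `<=` ~` B m.

(* [D m v] plays the role of the [v]-th dyadic interval of length [2 ^- m], and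
   [B m] of the set of points whose digit of index [m] is one. *)
Definition digit (t : T) (i : nat) : bool := t \in B i.

Definition walsh_fun n t : R := \1_(D 0 0) t * walsh R n (digit t).

Lemma measurable_digit (F : bool -> R) i :
  measurable_fun setT (fun t => F (digit t i)).
Proof.
have -> : (fun t => F (digit t i)) =
    (fun t => F false + (F true - F false) * \1_(B i) t).
  apply/funext => t; rewrite /digit indicE; case: (t \in B i).
    by rewrite mulr1 addrC subrK.
  by rewrite mulr0 addr0.
by apply: measurable_funD => //; apply: measurable_funM.
Qed.

Lemma measurable_digit_prod (F : nat -> bool -> R) (s : seq nat) :
  measurable_fun setT (fun t => \prod_(i <- s) F i (digit t i)).
Proof.
elim: s => [|i s IH]; first by under eq_fun do rewrite big_nil; exact: measurable_cst.
under eq_fun do rewrite big_cons.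
by apply: measurable_funM => //; exact: measurable_digit.
Qed.

(** On the unit interval the digits are independent fair coins. *)
Lemma integral_digit_prod (F : nat -> bool -> R) K m v c : (v < 2 ^ m)%N ->
  (\int[mu]_(t in D m v) (c * \prod_(m <= i < m + K) F i (digit t i))%:E =
   (c / 2 ^+ m * \prod_(m <= i < m + K) ((F i false + F i true) / 2))%:E)%E.
Proof.
elim: K m v c => [|K IH] m v c vm.
  under eq_integral do rewrite addn0 big_geq// mulr1.
  by rewrite integral_cst// muD// addn0 big_geq// mulr1.
have mf : measurable_fun setT
    (fun t => c * \prod_(m <= i < m + K.+1) F i (digit t i)).
  by apply: measurable_funM => //; exact: measurable_digit_prod.
have step (b : bool) : (\int[mu]_(t in D m.+1 (b + v.*2)%N)
    (c * \prod_(m <= i < m + K.+1) F i (digit t i))%:E =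
    ((c * F m b) / 2 ^+ m.+1 *
     \prod_(m.+1 <= i < m.+1 + K) ((F i false + F i true) / 2))%:E)%E.
  rewrite -(IH m.+1 (b + v.*2)%N); last by rewrite expnS; case: b; lia.
  apply: eq_integral => t; rewrite inE => Dt; rewrite big_ltn; last by lia.
  rewrite addSnnS mulrA; congr (_ * F m _ * _)%:E.
  rewrite /digit; case: b Dt => Dt; first by rewrite mem_set//; exact: DB Dt.
  by rewrite memNset//; exact: DnB Dt.
rewrite {1}D_split integral_setU//; last 2 first.
- by apply/measurable_EFinP; exact: measurable_funTS.
- rewrite disj_set2E; apply/eqP/seteqP; split=> // t [/DnB nB /DB]; exact: nB.
rewrite (step false) (step true) -EFinD; congr EFin.
rewrite [in RHS]big_ltn; last by lia.
rewrite addSnnS; have : 2 ^+ m != 0 :> R by rewrite expf_neq0.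
by rewrite exprS => m0; field.
Qed.

Lemma measurable_walsh_fun n : measurable_fun setT (walsh_fun n).
Proof.
apply: measurable_funM => //; rewrite /walsh.
under eq_fun => t.
  rewrite -(big_mkord xpredT (fun i => (-1) ^+ (bit n i && digit t i))).
  over.
exact: (measurable_digit_prod (fun i b => (-1) ^+ (bit n i && b))).
Qed.

Lemma walsh_orthonormal n m :
  (\int[mu]_t (walsh_fun n t * walsh_fun m t)%:E)%E = ((n == m)%:R)%:E.
Proof.
pose K := maxn n m; pose F i b : R := (-1) ^+ (bit n i && b) * (-1) ^+ (bit m i && b).
have nK : (n < 2 ^ K)%N by rewrite (leq_ltn_trans (leq_maxl n m))// ltn_expl.
have mK : (m < 2 ^ K)%N by rewrite (leq_ltn_trans (leq_maxr n m))// ltn_expl.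
have -> : (\int[mu]_t (walsh_fun n t * walsh_fun m t)%:E =
    \int[mu]_(t in D 0 0) (1 * \prod_(0 <= i < 0 + K) F i (digit t i))%:E)%E.
  rewrite [RHS]integral_mkcond; apply: eq_integral => t _; rewrite patchE /walsh_fun indicE.
  case: (t \in D 0 0); last by rewrite !mul0r.
  by rewrite !mul1r !(@walsh_trunc _ _ K)// add0n big_mkord -big_split.
rewrite integral_digit_prod// expr0 divr1 mul1r add0n big_mkord; congr EFin.
have [nm|nm] := eqVneq n m.
  rewrite big1// => i _; rewrite /F nm; case: (bit m i) => /=.
    by rewrite !expr1 mulrNN !mulr1; field.
  by rewrite !mulr1; field.
have [i ni] : exists i : 'I_K, bit n i != bit m i.
  apply: contrapT => H; move/eqP: nm; apply; apply: (bit_inj nK mK) => i iK.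
  apply/eqP; rewrite -[_ == _]negbK; apply/negP => ne; apply: H.
  by exists (Ordinal iK).
rewrite (bigD1 i)//= /F; move: ni; case: (bit n i); case: (bit m i) => // _ /=.
  by rewrite expr1 !mulr1 subrr mul0r mul0r.
by rewrite expr1 !mul1r subrr mul0r mul0r.
Qed.

Lemma walsh_fun_supp n t : ~ D 0 0 t -> walsh_fun n t = 0.
Proof. by move=> nD; rewrite /walsh_fun indicE memNset// mul0r. Qed.

Lemma normr_walsh_fun n t : `|walsh_fun n t| <= 1.
Proof.
rewrite /walsh_fun normrM normr_walsh mulr1 indicE.
by case: (_ \in _); rewrite ?normr1 ?normr0.
Qed.

(** Within a block the values of the Walsh functions at a point depend, up to a
    common factor, on as many digits as there are binary digits in the size of
    the block. *)
Lemma walsh_fun_block l q t : exists (c : 'I_(16 ^ l)) (u : R), `|u| <= 1 /\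
  forall j : 'I_(16 ^ l),
    walsh_fun (q * 16 ^ l + j) t = u * walsh R j (bit c).
Proof.
have E16 : (16 ^ l = 2 ^ (4 * l))%N by rewrite expnM.
have [c cl cdg] := bit_exists (4 * l) (digit t).
rewrite -E16 in cl; exists (Ordinal cl), (walsh_fun (q * 16 ^ l) t); split.
  exact: normr_walsh_fun.
move=> j; have jl : (j < 2 ^ (4 * l))%N by rewrite -E16.
rewrite /walsh_fun -mulrA; congr (_ * _).
have := walshM R q (digit t) jl; rewrite -E16 => ->; congr (_ * _).
by apply: (eq_walsh R jl) => i il /=; rewrite cdg.
Qed.

End dyadic.


(** * The half line *)

Section half_line.
Local Open Scope classical_set_scope.
Context (R : realType).
Local Notation mu := (half_line_measure R).

Lemma measurable_half_line_itv (i : interval R) :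
  ((@wlength R idfun)^*)%mu.-cara.-measurable [set` i].
Proof.
by apply: (sub_caratheodory (@wlength R idfun)); exact: (@measurable_itv R i).
Qed.

(** The completed measure and the Lebesgue measure are restrictions of the same
    outer measure. *)
Lemma half_line_measureE (A : set R) :
  mu A = (@lebesgue_measure R (A `&` `]0, +oo[)).
Proof. by []. Qed.

Definition dyadic m v : set R := `[v%:R / 2 ^+ m, v.+1%:R / 2 ^+ m[.

Lemma dyadic_inj m v v' t : dyadic m v t -> dyadic m v' t -> v = v'.
Proof.
have e0 : 0 < 2 ^+ m :> R by rewrite exprn_gt0.
rewrite /dyadic /= !in_itv/= !ler_pdivrMr// !ltr_pdivlMr//.
move=> /andP[h1 h2] /andP[h3 h4].
have := le_lt_trans h1 h4; have := le_lt_trans h3 h2.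
by rewrite !ltr_nat; lia.
Qed.

Lemma dyadic_split m v : dyadic m v = dyadic m.+1 v.*2 `|` dyadic m.+1 v.*2.+1.
Proof.
have e0 : 0 < 2 ^+ m :> R by rewrite exprn_gt0.
have e1 : 0 < 2 ^+ m.+1 :> R by rewrite exprn_gt0.
have n2 : v.*2%:R = 2 * v%:R :> R by rewrite -muln2 natrM mulrC.
have n3 : v.*2.+1%:R = 2 * v%:R + 1 :> R by rewrite -natr1 n2.
have n4 : v.*2.+2%:R = 2 * v%:R + 2 :> R by rewrite -natr1 n3; ring.
have n1 : v.+1%:R = v%:R + 1 :> R by rewrite natr1.
apply/seteqP; split=> t;
  rewrite /dyadic /= !in_itv/= !ler_pdivrMr// !ltr_pdivlMr//;
  rewrite n1 n2 n3 n4 exprS; move: (2 ^+ m) (v%:R : R) => q r.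
  move=> /andP[h1 h2]; have [h|h] := ltP (t * (2 * q)) (2 * r + 1).
    by left; apply/andP; split; lra.
  by right; apply/andP; split; lra.
by move=> [|] /andP[h1 h2]; apply/andP; split; lra.
Qed.

Lemma half_line_dyadic m v : mu (dyadic m v) = ((2 ^+ m)^-1)%:E.
Proof.
have e0 : 0 < 2 ^+ m :> R by rewrite exprn_gt0.
rewrite half_line_measureE.
have vv : v%:R / 2 ^+ m < v.+1%:R / 2 ^+ m :> R by rewrite ltr_pM2r ?invr_gt0// ltr_nat.
have len : v.+1%:R / 2 ^+ m - v%:R / 2 ^+ m = (2 ^+ m)^-1 :> R.
  by rewrite -natr1; ring.
case: v vv len => [|v] vv len.
  have -> : dyadic m 0 `&` `]0, +oo[ = `]0, 1%:R / 2 ^+ m[.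
    rewrite /dyadic mul0r; apply/seteqP; split=> t /=; rewrite !in_itv/=.
      by move=> [/andP[_ ->]]; rewrite andbT => ->.
    by move=> /andP[t0 ->]; rewrite t0 (ltW t0).
  rewrite lebesgue_measure_itv/= lte_fin; move: vv; rewrite mul0r => ->.
  by rewrite -EFinB subr0 mul1r.
have -> : dyadic m v.+1 `&` `]0, +oo[ = dyadic m v.+1.
  apply/seteqP; split=> t; first by case.
  move=> Dt; split=> //; move: Dt; rewrite /dyadic /= !in_itv/= andbT => /andP[h _].
  by apply: lt_le_trans h; rewrite divr_gt0.
by rewrite lebesgue_measure_itv/= lte_fin vv -EFinB len.
Qed.

Definition digit_set m : set R := \bigcup_n dyadic m.+1 n.*2.+1.

Lemma measurable_dyadic m v :
  ((@wlength R idfun)^*)%mu.-cara.-measurable (dyadic m v).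
Proof. exact: measurable_half_line_itv. Qed.

Lemma measurable_digit_set m :
  ((@wlength R idfun)^*)%mu.-cara.-measurable (digit_set m).
Proof. by apply: bigcup_measurable => n _; exact: measurable_dyadic. Qed.

Lemma dyadic_odd m v : dyadic m.+1 v.*2.+1 `<=` digit_set m.
Proof. by move=> t Dt; exists v. Qed.

Lemma dyadic_even m v : dyadic m.+1 v.*2 `<=` ~` digit_set m.
Proof. by move=> t Dt [n _ /(dyadic_inj Dt)]; lia. Qed.

Definition exhaustion (m : nat) : set R := `]-oo, m%:R].

Lemma half_line_exhaustion m : (mu (exhaustion m) < +oo)%E.
Proof.
rewrite half_line_measureE.
have -> : exhaustion m `&` `]0, +oo[ = `]0, m%:R].
  apply/seteqP; split=> t /=; rewrite /exhaustion /= !in_itv/= ?andbT; first by move=> [-> ->].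
  by move=> /andP[-> ->].
by rewrite lebesgue_measure_itv/=; case: ifP => _; rewrite -?EFinB ltry.
Qed.

End half_line.

Theorem theorem1 (R : realType) (p : R) (p1 : (1 <= p%:E)%E) :
  p != 2 ->
  ~ isomorphic (LpPlusLoo (half_line_measure R) p1)
               (LpCapLoo (half_line_measure R) p1).
Proof.
move=> p2 [f [g [fK _ [Cf f_bound] [Cg g_bound]]]].
have bound (V W : normedModType R) (k : V -> W) C :
    (forall x, `|k x| <= C * `|x|) -> forall x, `|k x| <= Num.max 1 C * `|x|.
  by move=> kC x; rewrite (le_trans (kC x))// ler_wpM2r// le_max lexx orbT.
have max0 C : 0 < Num.max 1 C :> R by rewrite lt_max ltr01.
have D1 : half_line_measure R (@dyadic R 0 0) = 1%:E.
  by rewrite half_line_dyadic expr0 invr1.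
refine (@no_isomorphism _ _ R (half_line_measure R) p p1 (@dyadic R 0 0)
  (@measurable_dyadic R 0 0) D1
  (walsh_fun R (@dyadic R) (@digit_set R)) _ _ _ _ f g (Num.max 1 Cf) (Num.max 1 Cg)
  fK (max0 _) (max0 _) (bound _ _ _ _ f_bound) (bound _ _ _ _ g_bound)
  (fun l j c => walsh R j (bit c)) _ _ (@exhaustion R) _ _ _ _ p2).
- by move=> n; apply: measurable_walsh_fun; [exact: measurable_dyadic|exact: measurable_digit_set].
- by move=> n t; exact: walsh_fun_supp.
- by move=> n t; exact: normr_walsh_fun.
- move=> n m; apply: walsh_orthonormal.
  + exact: measurable_dyadic.
  + exact: measurable_digit_set.
  + by move=> k v _; rewrite half_line_dyadic.
  + exact: dyadic_split.
  + exact: dyadic_odd.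
  + exact: dyadic_even.
- by move=> l j c; rewrite normr_walsh.
- by move=> l q t; exact: walsh_fun_block.
- by move=> m; exact: measurable_half_line_itv.
- move=> m n mn; rewrite subsetEset => t; rewrite /exhaustion /= !in_itv/=.
  by move=> /le_trans; apply; rewrite ler_nat.
- move=> t; exists (Num.trunc `|t|).+1; rewrite /exhaustion /= in_itv/=.
  by apply: (le_trans (ler_norm _)); apply: ltW; exact: truncnS_gt.
- exact: half_line_exhaustion.
Qed.
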